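(* Let $G=(V,E)$ be an undirected graph, $K\subseteq V$ with $k=|K|$ even, $f:(\{0,1\}^n)^K\to\{0,1\}$, $\epsilon\ge0$, and $h:[k/2]\times[k/2]\to\mathbb{R}_{\ge0}$. Assume that for every pair of disjoint sets $A,B\subseteq K$ with $|A|,|B|\le k/2$ there exists $\tilde{\mathbf{x}}\in(\{0,1\}^n)^{K\setminus(A\cup B)}$ such that $R^{(2)}_\epsilon(f_{A,B,\tilde{\mathbf{x}}})\ge h(|A|,|B|)$. Then \[\tau_{\mathrm{MCF}}(G,K,n')\le\tilde O\big(R_\epsilon(f,G,K)\big),\qquad\text{where } n'=\min_{y,z\in[0,k/2]:\,y+z>k/2}\frac{h(y,z)}{y+z-k/2}.\]
   Context: Communication model: each terminal $u\in K$ holds $\mathbf{x}_u\in\{0,1\}^n$; all terminals must learn $f$; in each synchronous round every node sends a (possibly different) bit to each neighbour, both directions usable simultaneously; protocols know $G$ and use public randomness. $R_\epsilon(f,G,K)$: minimum worst-case number of rounds of a protocol erring with probability $\le\epsilon$ on every input. $R^{(2)}_\epsilon(g)$: randomized round complexity of a two-party function $g$ (inputs may come from different domains) when Alice and Bob may each send one bit to the other simultaneously per round. For disjoint $A,B\subseteq K$ and $\tilde{\mathbf{x}}\in(\{0,1\}^n)^{K\setminus(A\cup B)}$, $f_{A,B,\tilde{\mathbf{x}}}(\mathbf{x}_A,\mathbf{x}_B)=f(\mathbf{y})$ with $\mathbf{y}[v]=\mathbf{x}_A[v]$ for $v\in A$, $\mathbf{x}_B[v]$ for $v\in B$, $\tilde{\mathbf{x}}[v]$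 otherwise. Timed graph $G^{(\tau)}$: directed graph on $V\times[0,\tau]$ with unit-capacity edges $((u,i),(v,i+1))$, $((v,i),(u,i+1))$ for $(u,v)\in E$, $0\le i<\tau$, and infinite-capacity edges $((u,i),(u,i+1))$. $\tau_{\mathrm{MCF}}(G,K,n')$: minimum $\tau$ such that a capacity-respecting multicommodity flow in $G^{(\tau)}$ sends $n'/k$ units from $(u,0)$ to $(v,\tau)$ for every ordered pair $u,v\in K$. $\tilde O$ ignores poly-logarithmic factors in the size of $G$ and $n$. *)

(* Defs.v *)
From HB Require Import structures.
From mathcomp Require Import all_boot all_order all_algebra.
From mathcomp Require Import boolp classical_sets reals ereal exp.

Set Implicit Arguments.
Unset Strict Implicit.
Unset Printing Implicit Defensive.

Import Order.TTheory GRing.Theory Num.Theory.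
Local Open Scope classical_set_scope.
Local Open Scope ring_scope.

(* An undirected graph is a symmetric irreflexive e : rel V on a finType V. *)

Definition inputs (V : finType) (n : nat) (S : {set V}) : Type :=
  {ffun {u : V | u \in S} -> n.-tuple bool}.

Definition lookup (V : finType) (n : nat) (S : {set V}) (x : inputs n S)
    (v : V) : option (n.-tuple bool) :=
  omap x (insub v).

(* The public random string.  Finite sample spaces lose no generality: for a
   fixed number of rounds and finite inputs there are, extensionally, only
   finitely many deterministic protocols. *)
Record public_coins (R : realType) := PublicCoins {
  coins :> finType;
  mass : coins -> R;
  mass_ge0 : forall w, 0 <= mass w;
  mass_sum1 : \sum_w mass w = 1
}.

Definition prob (R : realType) (W : public_coins R) (E : pred W) : R :=
  \sum_(w | E w) mass w.

Section Network.
Variables (V : finType) (n : nat) (W : Type).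

(* What a node has received so far: entry i lists the bits that arrived in
   round i, indexed by sender (false at non-neighbours). *)
Definition history := seq {ffun V -> bool}.

(* The local input is None at non-terminals. The last argument of send is the
   addressee. *)
Record protocol := Protocol {
  send : V -> W -> option (n.-tuple bool) -> history -> V -> bool;
  output : V -> W -> option (n.-tuple bool) -> history -> bool
}.

Fixpoint received (e : rel V) (p : protocol) (w : W)
    (loc : V -> option (n.-tuple bool)) (r : nat) (v : V) : history :=
  if r is r'.+1 then
    rcons (received e p w loc r' v)
      [ffun u => e u v && send p u w (loc u) (received e p w loc r' u) v]
  else [::].

Definition correct (e : rel V) (K : {set V}) (f : inputs n K -> bool)
    (p : protocol) (r : nat) (x : inputs n K) (w : W) : bool :=
  [forall v in K,
     output p v w (lookup x v) (received e p w (lookup x) r v) == f x].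
End Network.

Definition computable_in (R : realType) (V : finType) (n : nat) (eps : R)
    (e : rel V) (K : {set V}) (f : inputs n K -> bool) (r : nat) : Prop :=
  exists (W : public_coins R) (p : protocol V n W),
    forall x : inputs n K, prob [pred w : W | ~~ correct e f p r x w] <= eps.

(* Minimum of a set of naturals, +oo when the set is empty. *)
Definition emin (R : realType) (P : nat -> Prop) : \bar R :=
  ereal_inf [set (r%:R)%:E | r in [set r | P r]].

Definition round_complexity (R : realType) (V : finType) (n : nat) (eps : R)
    (e : rel V) (K : {set V}) (f : inputs n K -> bool) : \bar R :=
  emin R (computable_in eps e f).

Section TwoParty.
Variables (X Y W : Type).

Record protocol2 := Protocol2 {
  send_alice : W -> X -> seq bool -> bool;
  send_bob : W -> Y -> seq bool -> bool;
  output_alice : W -> X -> seq bool -> bool;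
  output_bob : W -> Y -> seq bool -> bool
}.

(* Bits received after r rounds by (Alice, Bob). *)
Fixpoint received2 (p : protocol2) (w : W) (x : X) (y : Y) (r : nat) :
    seq bool * seq bool :=
  if r is r'.+1 then
    let: (ha, hb) := received2 p w x y r' in
    (rcons ha (send_bob p w y hb), rcons hb (send_alice p w x ha))
  else ([::], [::]).

Definition correct2 (g : X -> Y -> bool) (p : protocol2) (r : nat)
    (x : X) (y : Y) (w : W) : bool :=
  let: (ha, hb) := received2 p w x y r in
  (output_alice p w x ha == g x y) && (output_bob p w y hb == g x y).
End TwoParty.

Definition computable2_in (R : realType) (X Y : Type) (eps : R)
    (g : X -> Y -> bool) (r : nat) : Prop :=
  exists (W : public_coins R) (p : protocol2 X Y W),
    forall x y, prob [pred w : W | ~~ correct2 g p r x y w] <= eps.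

Definition round_complexity2 (R : realType) (X Y : Type) (eps : R)
    (g : X -> Y -> bool) : \bar R :=
  emin R (computable2_in eps g).

(* f_{A,B,xt}.  The all-false default is never reached: every v in K lies in
   A, in B, or in K :\: (A :|: B). *)
Definition induced (V : finType) (n : nat) (K : {set V})
    (f : inputs n K -> bool) (A B : {set V}) (xt : inputs n (K :\: (A :|: B)))
    (xA : inputs n A) (xB : inputs n B) : bool :=
  f [ffun v : {u : V | u \in K} =>
       if lookup xA (val v) is Some b then b
       else if lookup xB (val v) is Some b then b
       else odflt (nseq_tuple n false) (lookup xt (val v))].

Section TimedFlow.
Variables (R : realType) (V : finType) (e : rel V) (tau : nat).

Definition timed_vertex : finType := (V * 'I_tau.+1)%type.

(* Capacity 0 encodes the absence of an edge. *)
Definition capacity (a b : timed_vertex) : \bar R :=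
  if b.2 != a.2.+1 :> nat then 0%E
  else if a.1 == b.1 then +oo%E
  else if e a.1 b.1 then 1%E
  else 0%E.

Definition sends (phi : timed_vertex -> timed_vertex -> R) (d : R)
    (s t : timed_vertex) : Prop :=
  (forall a b, 0 <= phi a b) /\
  (forall a, \sum_b phi a b - \sum_b phi b a = d *+ (a == s) - d *+ (a == t)).

Definition mcf_feasible (K : {set V}) (d : R) : Prop :=
  exists phi : V -> V -> timed_vertex -> timed_vertex -> R,
    (forall u v, u \in K -> v \in K ->
       sends (phi u v) d (u, ord0) (v, ord_max)) /\
    (forall a b,
       ((\sum_(u in K) \sum_(v in K) phi u v a b)%:E <= capacity a b)%E).
End TimedFlow.

Definition tau_MCF (R : realType) (V : finType) (e : rel V) (K : {set V})
    (n' : R) : \bar R :=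
  emin R (fun tau => mcf_feasible e tau K (n' / #|K|%:R)).

(* The index set is finite, and nonempty for even k > 0, so inf is a minimum.
   The constraints force y, z >= 1. *)
Definition min_ratio (R : realType) (k : nat) (h : nat -> nat -> R) : R :=
  inf [set q | exists y z : nat,
    [/\ (y <= k./2)%N, (z <= k./2)%N, (k./2 < y + z)%N &
        q = h y z / (y%:R + z%:R - (k./2)%:R)]].

(* Main.v *)
Require Import Defs.
From mathcomp Require Import all_boot all_order all_algebra.
From mathcomp Require Import boolp classical_sets reals ereal exp sequences.
From mathcomp Require Import zify ring lra.

(** Let [p] be an [r]-round protocol, and bisect [K] into [A] and [B].  A cut of
    the timed graph over [2r] rounds that avoids the infinite edges is an
    increasing family [U 0, ..., U (2r)].  At time [i <= r] let Alice know the
    nodes in [U (2r - i)] and Bob those outside [U i]: the messages crossing the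
    first half of the cut are what Bob lacks, those crossing its second half,
    read backwards in time, are what Alice lacks.  So [p] becomes a two-party
    protocol with as many rounds as the cut has edges, and the hardness
    hypothesis says that the cut is large.  By max-flow min-cut, every bisection
    of [K] carries a flow of [n'] units (up to rounding) out of each node of [A]
    and into each node of [B] in [2r] rounds.

    These flows play the matching player of the cut-matching game of Khandekar,
    Rao and Vazirani.  Each terminal starts with a commodity of its own; in each
    round a bisection is chosen by projecting the current distributions on a
    random sign vector and cutting at the median, and half of everything is
    exchanged along the flow.  The squared distance to the uniform distribution
    drops by a factor [1 - 1/polylog], so after polylogarithmically many rounds
    every pair of terminals has exchanged the right amount up to a constant. *)

Set Implicit Arguments.
Unset Strict Implicit.
Unset Printing Implicit Defensive.

Import Order.TTheory GRing.Theory Num.Theory.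
Local Open Scope ring_scope.

(** * Integral flows with supplies and demands *)

Section Gale.
Variable X : finType.

Fixpoint traversals (x : X) (p : seq X) (u v : X) : nat :=
  if p is y :: p' then ((u == x) && (v == y) + traversals y p' u v)%N else 0%N.

Lemma traversals_notin x p u v : u \notin x :: p -> traversals x p u v = 0%N.
Proof.
elim: p x => [|y p IH] x //=; rewrite inE negb_or => /andP[/negPf -> up].
by rewrite IH.
Qed.

Lemma traversals_le1 x p u v : uniq (x :: p) -> (traversals x p u v <= 1)%N.
Proof.
elim: p x => [|y p IH] x //= /andP[xp up]; case: eqP => [->|_] /=; last exact: IH.
by rewrite traversals_notin // addn0; case: (_ == _).
Qed.

Lemma traversals_path (r : rel X) x p u v :
  path r x p -> (0 < traversals x p u v)%N -> r u v.
Proof.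
elim: p x => [|y p IH] x //= /andP[rxy rp].
case: (u =P x) => [eu|_] /=; last exact: IH.
case: (v =P y) => [ev|_] /=; last exact: IH.
by rewrite eu ev.
Qed.

Lemma traversals_net x p u :
  \sum_v (traversals x p u v)%:Z - \sum_v (traversals x p v u)%:Z =
  (u == x)%:Z - (u == last x p)%:Z.
Proof.
elim: p x => [|y p IH] x /=; first by rewrite !big1 // !subrr.
under eq_bigr do rewrite PoszD.
under [X in _ - X]eq_bigr do rewrite PoszD.
rewrite !big_split /= opprD addrACA IH.
have -> : \sum_v ((u == x) && (v == y))%:Z = (u == x)%:Z.
  rewrite (bigD1 y) //= big1 ?addr0 ?eqxx ?andbT // => v /negPf ->.
  by rewrite andbF.
have -> : \sum_v ((v == x) && (u == y))%:Z = (u == y)%:Z.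
  by rewrite (bigD1 x) //= big1 ?addr0 ?eqxx // => v /negPf ->.
lia.
Qed.

Variables (c : X -> X -> nat) (supply demand : X -> nat) (A : {set X}).

(** Flows are skew-symmetric, so [\sum_v f u v] is the net outflow of [u] and [c u v - f u v] a
    residual capacity. The supply bounds the net outflow in [A], the demand the net inflow
    elsewhere; [m] is the value. *)
Definition partial_flow (f : X -> X -> int) (m : nat) : Prop :=
  [/\ forall u v, f u v = - f v u,
      forall u v, f u v <= (c u v)%:Z,
      forall u, u \in A -> \sum_v f u v <= (supply u)%:Z,
      forall u, u \notin A -> - (demand u)%:Z <= \sum_v f u v &
      \sum_(u in A) \sum_v f u v = m%:Z].

Hypothesis cut : forall S : {set X},
  (\sum_(u in A | u \in S) supply u <=
   \sum_(u in S | u \notin A) demand u + \sum_(u in S) \sum_(v | v \notin S) c u v)%N.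

Lemma sum_Posz (P : pred X) (F : X -> nat) :
  \sum_(u | P u) (F u)%:Z = (\sum_(u | P u) F u)%N%:Z.
Proof. by apply/esym; apply: (big_morph Posz PoszD). Qed.

Lemma skew_sum0 (S : {set X}) (f : X -> X -> int) :
  (forall u v, f u v = - f v u) -> \sum_(u in S) \sum_(v in S) f u v = 0.
Proof.
move=> fN; set s := LHS; suff : s = - s by lia.
rewrite {1}/s exchange_big /= -sumrN; apply: eq_bigr => u _.
by rewrite -sumrN; apply: eq_bigr => v _.
Qed.

(** A Ford-Fulkerson step. [S] is what residual edges reach from unsaturated supplies. If it
    contains an unsaturated demand, one unit is pushed along a residual path. Otherwise the edges
    leaving [S], the demands in [S] and the supplies outside [S] are all saturated, and [cut S]
    makes the value maximal. *)
Lemma partial_flow_augment f m :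
  partial_flow f m -> (m < \sum_(u in A) supply u)%N ->
  exists f', partial_flow f' m.+1.
Proof.
case=> fN fc fA fB fm lt_m.
pose res := [rel u v | f u v < (c u v)%:Z].
pose S := [set w | [exists u, [&& u \in A, \sum_v f u v < (supply u)%:Z & connect res u w]]].
case: (boolP [exists w, [&& w \in S, w \notin A & - (demand w)%:Z < \sum_v f w v]]).
  case/existsP=> w /and3P[]; rewrite inE => /existsP[u /and3P[uA ltu /connectP[p0 rp0 ->]]].
  case/shortenP: rp0 => p rp up _ wA ltw.
  (* The unit flow along [p], made skew-symmetric. As [p] is simple, it adds at most one to any
     edge, and only to residual edges. *)
  pose g a b : int := (traversals u p a b)%:Z - (traversals u p b a)%:Z.
  have netg a : \sum_v (f a v + g a v) = \sum_v f a v + ((a == u)%:Z - (a == last u p)%:Z).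
    by rewrite big_split /= -traversals_net sumrB.
  exists (fun a b => f a b + g a b); split.
  - by move=> a b; rewrite fN /g; lia.
  - move=> a b; have := fc a b; have := traversals_le1 a b up.
    have := @traversals_path res u p a b rp; rewrite /= /g.
    case: (traversals u p a b) => [|[|q]] //=; first by lia.
    by move/(_ isT); lia.
  - move=> a aA; rewrite netg; have := fA a aA.
    have -> : (a == last u p) = false by apply/negP => /eqP ea; rewrite -ea aA in wA.
    case: eqP => [->|_]; lia.
  - move=> a aA; rewrite netg; have := fB a aA.
    have -> : (a == u) = false by apply/negP => /eqP ea; rewrite ea uA in aA.
    case: eqP => [->|_]; last lia.
    by move=> _; rewrite sub0r lerBrDr -lezD1 in ltw *.
  - under eq_bigr do rewrite netg.
    rewrite big_split /= fm sumrB.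
    have -> : \sum_(i in A) (i == u)%:Z = 1.
      by rewrite (bigD1 u) //= eqxx big1 ?addr0 // => i /andP[_ /negPf ->].
    rewrite big1; first by lia.
    by move=> i iA; case: eqP => // ei; rewrite -ei iA in wA.
move=> /existsPn noaug; exfalso.
have SB w : w \in S -> w \notin A -> \sum_v f w v = - (demand w)%:Z.
  move=> wS wA; have := noaug w; rewrite wS wA /= => h.
  by apply/eqP; rewrite eq_le fB // andbT leNgt.
have SA w : w \in A -> w \notin S -> \sum_v f w v = (supply w)%:Z.
  move=> wA wS; have := fA w wA; rewrite le_eqVlt => /predU1P[//|lt].
  by case/negP: wS; rewrite inE; apply/existsP; exists w; rewrite wA lt connect0.
have Sc u v : u \in S -> v \notin S -> f u v = (c u v)%:Z.
  move=> uS vS; have := fc u v; rewrite le_eqVlt => /predU1P[//|lt].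
  case/negP: vS; move: uS; rewrite !inE => /existsP[a /and3P[aA la ca]].
  apply/existsP; exists a; rewrite aA la /=; apply: connect_trans ca _.
  exact: connect1.
have E1 : \sum_(u in S) \sum_v f u v = \sum_(u in S) \sum_(v | v \notin S) (c u v)%:Z.
  under eq_bigr do rewrite (bigID (mem S)) /=.
  rewrite big_split /= skew_sum0 // add0r.
  by apply: eq_bigr => u uS; apply: eq_bigr => v vS; exact: Sc.
have E2 : \sum_(u in S) \sum_v f u v =
    \sum_(u in A | u \in S) \sum_v f u v - \sum_(u in S | u \notin A) (demand u)%:Z.
  rewrite (bigID (mem A)) /=; congr (_ + _).
    by apply: eq_bigl => u; rewrite andbC.
  by rewrite -sumrN; apply: eq_bigr => u /andP[uS uA]; exact: SB.
have E3 : \sum_(u in A) \sum_v f u v =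
    \sum_(u in A | u \in S) \sum_v f u v + \sum_(u in A | u \notin S) (supply u)%:Z.
  rewrite (bigID (mem S)) /=; congr (_ + _).
  by apply: eq_bigr => u /andP[uS uA]; exact: SA.
have := cut S; rewrite (bigID (mem S)) /= in lt_m.
have toZ2 : \sum_(u in S) \sum_(v | v \notin S) (c u v)%:Z =
    (\sum_(u in S) \sum_(v | v \notin S) c u v)%N%:Z.
  by rewrite -sum_Posz; apply: eq_bigr => u _; rewrite sum_Posz.
move: E1 E2 E3 fm lt_m; rewrite toZ2 !sum_Posz.
lia.
Qed.

(** Repeated augmentation meets the total supply. The net outflows sum to zero, so the total demand
    is met too, and termwise inequalities with equal sums are equalities. *)
Lemma gale : (\sum_(u in A) supply u = \sum_(u | u \notin A) demand u)%N ->
  exists f : X -> X -> int,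
  [/\ forall u v, f u v = - f v u,
      forall u v, f u v <= (c u v)%:Z,
      forall u, u \in A -> \sum_v f u v = (supply u)%:Z &
      forall u, u \notin A -> \sum_v f u v = - (demand u)%:Z].
Proof.
move=> bal.
have [f [fN fc fA fB fm]] : exists f, partial_flow f (\sum_(u in A) supply u).
  have : (\sum_(u in A) supply u <= \sum_(u in A) supply u)%N by [].
  move: {1 3}(\sum_(u in A) supply u)%N => m.
  elim: m => [_|m IH lt_m].
    exists (fun _ _ => 0); split=> [u v|u v|u _|u _|]; rewrite ?oppr0 ?big1 //; lia.
  by have [f ff] := IH (ltnW lt_m); exact: partial_flow_augment ff lt_m.
have f0 : \sum_u \sum_v f u v = 0.
  rewrite -[RHS](@skew_sum0 [set: X]%SET f) //.
  under [RHS]eq_bigl do rewrite inE.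
  by apply: eq_bigr => u _; apply: eq_bigl => v; rewrite inE.
exists f; split=> // u uA.
  have : \sum_(u in A) ((supply u)%:Z - \sum_v f u v) = 0.
    by rewrite sumrB fm sum_Posz subrr.
  move/eqP; rewrite psumr_eq0 => [/allP/(_ u (mem_index_enum u))|v vA].
    by rewrite uA /= subr_eq0 => /eqP.
  by rewrite subr_ge0 fA.
have : \sum_(u | u \notin A) (\sum_v f u v + (demand u)%:Z) = 0.
  move: f0; rewrite (bigID (mem A)) /= big_split /= fm sum_Posz -bal; lia.
move/eqP; rewrite psumr_eq0 => [/allP/(_ u (mem_index_enum u))|v vA].
  by rewrite uA /= addr_eq0 => /eqP.
by have := fB v vA; lia.
Qed.

End Gale.

(** * Two-party simulation across a timed cut *)

(** A party that has seen [h] asks whether some input of the other party consistent with [h] gives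
    [true]; this is the right value as soon as the view determines it. *)
Definition decode (Y : Type) (view : Y -> seq bool) (val : Y -> bool)
    (h : seq bool) : bool := `[< exists y, view y = h /\ val y >].

Lemma decodeE (Y : Type) (view : Y -> seq bool) (val : Y -> bool) y :
  (forall y', view y' = view y -> val y' = val y) ->
  decode view val (view y) = val y.
Proof.
move=> det; apply/asboolP/idP => [[y' [/det <-]] //|vy]; by exists y.
Qed.

(* A two-party protocol need only be given semantically: a list of bits to be
   exchanged, each determined by its sender's input together with the bits the
   sender received earlier. *)
Lemma protocol2_of_events (X Y W : Type) (T : eqType) (ev : seq T)
    (own : pred T) (val : W -> T -> X -> Y -> bool) (outA outB : W -> X -> Y -> bool) :
  (forall w x y y' s1 t s2, ev = s1 ++ t :: s2 -> own t ->
     (forall t', t' \in s1 -> ~~ own t' -> val w t' x y = val w t' x y') ->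
     val w t x y = val w t x y') ->
  (forall w x x' y s1 t s2, ev = s1 ++ t :: s2 -> ~~ own t ->
     (forall t', t' \in s1 -> own t' -> val w t' x y = val w t' x' y) ->
     val w t x y = val w t x' y) ->
  (forall w x y y',
     (forall t, t \in ev -> ~~ own t -> val w t x y = val w t x y') ->
     outA w x y = outA w x y') ->
  (forall w x x' y,
     (forall t, t \in ev -> own t -> val w t x y = val w t x' y) ->
     outB w x y = outB w x' y) ->
  exists p : protocol2 X Y W, forall w x y,
    let: (ha, hb) := received2 p w x y (size ev) in
    output_alice p w x ha = outA w x y /\ output_bob p w y hb = outB w x y.
Proof.
move=> detA detB doutA doutB.
(* Round [i] serves event [i]: its owner sends the value while the other party sends a dummy
   [false]. The length of the history tells the round. *)
pose bitsA w x y := [seq own t && val w t x y | t <- ev].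
pose bitsB w x y := [seq ~~ own t && val w t x y | t <- ev].
have splitev r : (r < size ev)%N -> exists t s2,
    ev = take r ev ++ t :: s2 /\ forall F : T -> bool, nth false (map F ev) r = F t.
  move=> lt_r; have [t0 _] : exists t0 : T, True by case: (ev) lt_r => // t0; exists t0.
  exists (nth t0 ev r), (drop r.+1 ev); rewrite -drop_nth // cat_take_drop; split=> // F.
  exact: nth_map.
pose p := Protocol2
  (fun w x h => decode (fun y => take (size h) (bitsB w x y))
                       (fun y => nth false (bitsA w x y) (size h)) h)
  (fun w y h => decode (fun x => take (size h) (bitsA w x y))
                       (fun x => nth false (bitsB w x y) (size h)) h)
  (fun w x => decode (bitsB w x) (outA w x))
  (fun w y => decode (bitsA w ^~ y) (outB w ^~ y)).
have sendA w x y r : (r < size ev)%N ->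
    send_alice p w x (take r (bitsB w x y)) = nth false (bitsA w x y) r.
  move=> lt_r; rewrite /= size_takel ?size_map 1?ltnW //.
  rewrite (@decodeE _ (fun y => take r (bitsB w x y))) // => y'.
  rewrite /bitsA /bitsB -!map_take => /eq_in_map agree.
  have [t [s2 [evE nthE]]] := splitev r lt_r; rewrite !nthE.
  case: (boolP (own t)) => //= ot; apply: (detA _ _ _ _ _ _ _ evE ot) => t' t's ot'.
  by have := agree t' t's; rewrite ot'.
have sendB w x y r : (r < size ev)%N ->
    send_bob p w y (take r (bitsA w x y)) = nth false (bitsB w x y) r.
  move=> lt_r; rewrite /= size_takel ?size_map 1?ltnW //.
  rewrite (@decodeE _ (fun x => take r (bitsA w x y))) // => x'.
  rewrite /bitsA /bitsB -!map_take => /eq_in_map agree.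
  have [t [s2 [evE nthE]]] := splitev r lt_r; rewrite !nthE.
  case: (boolP (own t)) => //= ot; apply: (detB _ _ _ _ _ _ _ evE ot) => t' t's ot'.
  by have := agree t' t's; rewrite ot'.
have recE w x y r : (r <= size ev)%N ->
    received2 p w x y r = (take r (bitsB w x y), take r (bitsA w x y)).
  elim: r => [|r IH] lt_r; first by rewrite !take0.
  rewrite (take_nth false) ?size_map // [in RHS](take_nth false) ?size_map //.
  by rewrite -sendA // -sendB // [LHS]/= IH 1?ltnW.
exists p => w x y; rewrite recE // !take_oversize ?size_map //=; split.
  apply: decodeE => y' /eq_in_map agree; apply: doutA => t tev ot.
  by have := agree t tev; rewrite ot.
apply: (@decodeE _ (bitsA w ^~ y) (outB w ^~ y)) => x' /eq_in_map agree.
by apply: doutB => t tev ot; have := agree t tev; rewrite ot.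
Qed.

(** A node of [D i.+1] already lay in [D i], so its earlier history agrees; each new bit comes
    either from a sender in [D i], whose state agrees, or across the boundary, where agreement is
    assumed. *)
Lemma received_agree (V : finType) (n : nat) (W : Type) (e : rel V)
    (p : protocol V n W) (w : W) (loc loc' : V -> option (n.-tuple bool))
    (D : nat -> {set V}) (t : nat) :
  (forall i, (i < t)%N -> D i.+1 \subset D i) ->
  {in D 0%N, loc =1 loc'} ->
  (forall i u v, (i < t)%N -> e u v -> u \notin D i -> v \in D i.+1 ->
     send p u w (loc u) (received e p w loc i u) v =
     send p u w (loc' u) (received e p w loc' i u) v) ->
  forall i, (i <= t)%N ->
    {in D i, forall v, loc v = loc' v /\ received e p w loc i v = received e p w loc' i v}.
Proof.
move=> decD locD bdry; elim=> [|i IH] lt_i v vD /=; first by split=> //; exact: locD.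
have vD2 : v \in D i by exact: (fintype.subsetP (decD i lt_i)).
have [lv rv] := IH (ltnW lt_i) v vD2; split=> //; rewrite rv; congr rcons.
apply/ffunP => u; rewrite !ffunE; case: (boolP (e u v)) => //= euv.
have [uD|uD] := boolP (u \in D i); last exact: bdry.
by have [-> ->] := IH (ltnW lt_i) u uD.
Qed.

Section CutSimulation.
Variables (V : finType) (n : nat) (K : {set V}).

(** The argument that [induced] passes to [f]: [induced f xt xA xB] is [f (glue xt xA xB)] by
    conversion. *)
Definition glue (A B : {set V}) (xt : inputs n (K :\: (A :|: B)))
    (xA : inputs n A) (xB : inputs n B) : inputs n K :=
  [ffun v : {u : V | u \in K} =>
       if lookup xA (val v) is Some b then b
       else if lookup xB (val v) is Some b then b
       else odflt (nseq_tuple n false) (lookup xt (val v))].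

Lemma lookup_notin (S : {set V}) (x : inputs n S) v : v \notin S -> lookup x v = None.
Proof. by move=> vS; rewrite /lookup insubN. Qed.

Lemma lookup_glue_notinr (A B : {set V}) (xt : inputs n (K :\: (A :|: B))) xA xB xB' v :
  v \notin B -> lookup (glue xt xA xB) v = lookup (glue xt xA xB') v.
Proof.
move=> vB; rewrite /lookup; case: insubP => [u _ uv|] //; rewrite /omap /obind /oapp.
by rewrite !ffunE uv !(lookup_notin _ vB).
Qed.

Lemma lookup_glue_notinl (A B : {set V}) (xt : inputs n (K :\: (A :|: B))) xA xA' xB v :
  v \notin A -> lookup (glue xt xA xB) v = lookup (glue xt xA' xB) v.
Proof.
move=> vA; rewrite /lookup; case: insubP => [u _ uv|] //; rewrite /omap /obind /oapp.
by rewrite !ffunE uv !(lookup_notin _ vA).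
Qed.

Variables (R : realType) (eps : R) (e : rel V) (f : inputs n K -> bool) (r : nat).
Hypothesis e_sym : symmetric e.

(** The unit-capacity edges that leave the set of timed vertices whose layer [i] is [U i]. *)
Definition timed_cut (U : nat -> {set V}) : {set 'I_(r.*2) * (V * V)} :=
  [set t : 'I_(r.*2) * (V * V) | [&& e t.2.1 t.2.2, t.2.1 \in U t.1 & t.2.2 \notin U t.1.+1]].

(** The regions [U (2r - i)] of Alice and [~: U i] of Bob shrink with time but at time [r] still
    contain [A] and [B]. So [a0] and [b0] stay under observation to the end, and their outputs are
    the answers. For each random string, an error of the simulation is an error of [p]. *)
Lemma cut_simulation (U : nat -> {set V}) (A B : {set V})
    (xt : inputs n (K :\: (A :|: B))) (a0 b0 : V) :
  (forall i, (i < r.*2)%N -> U i \subset U i.+1) ->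
  A \subset K -> B \subset K -> A \subset U 0%N -> [disjoint B & U r.*2] ->
  a0 \in A -> b0 \in B ->
  computable_in eps e f r ->
  computable2_in eps (induced f xt) #|timed_cut U|.
Proof.
move=> Uinc AK BK AU BU a0A b0B [W [p pP]].
have Umono i j : (i <= j)%N -> (j <= r.*2)%N -> U i \subset U j.
  elim: j => [|j IH]; first by rewrite leqn0 => /eqP ->.
  rewrite leq_eqVlt => /predU1P[-> //|lt_ij] lt_j.
  by apply: fintype.subset_trans (Uinc j lt_j); apply: IH => //; exact: ltnW.
(* An edge of layer [j] is sent by Alice at time [j] if [j < r], and otherwise,
   reversed, by Bob at time [2r - j - 1]. *)
pose phase (t : 'I_(r.*2) * (V * V)) := minn t.1 (r.*2 - t.1.+1).
(* The phase is the time at which the message is sent. A message depends only on messages of smaller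
   phase, so the order within a phase is immaterial. *)
pose ev := sort (relpre phase leq) (enum (timed_cut U)).
have ev_sorted : pairwise (relpre phase leq) ev.
  rewrite -sorted_pairwise; first by apply: sort_sorted => x y; exact: leq_total.
  by move=> x y z; exact: leq_trans.
have mem_ev t : (t \in ev) = (t \in timed_cut U) by rewrite mem_sort mem_enum.
have earlier s1 t s2 t' : ev = s1 ++ t :: s2 -> t' \in timed_cut U ->
    (phase t' < phase t)%N -> t' \in s1.
  move=> evE t'C lt_ph; have := ev_sorted; rewrite evE pairwise_cat /=.
  case/and3P=> _ _ /andP[/allP s2ge _]; move: t'C.
  rewrite -mem_ev evE mem_cat inE => /or3P[//|/eqP tE|/s2ge /= le_ph].
    by rewrite tE ltnn in lt_ph.
  by rewrite ltnNge le_ph in lt_ph.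
pose loc x y := lookup (glue xt x y).
pose snd w x y i u v := send p u w (loc x y u) (received e p w (loc x y) i u) v.
pose own (t : 'I_(r.*2) * (V * V)) := (t.1 < r)%N.
pose val w (t : 'I_(r.*2) * (V * V)) x y :=
  if own t then snd w x y t.1 t.2.1 t.2.2 else snd w x y (r.*2 - t.1.+1)%N t.2.2 t.2.1.
pose out v w x y := output p v w (loc x y v) (received e p w (loc x y) r v).
have knowA w x y y' j : (j <= r)%N ->
    (forall t, t \in timed_cut U -> ~~ own t -> (phase t < j)%N ->
       val w t x y = val w t x y') ->
    {in U (r.*2 - j)%N, forall v, loc x y v = loc x y' v /\
       received e p w (loc x y) j v = received e p w (loc x y') j v}.
  move=> le_j agree.
  apply: (@received_agree _ _ _ e p w _ _ (fun i => U (r.*2 - i)%N) j) => //.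
  - by move=> i lt_i; apply: Umono; clear -lt_i le_j; lia.
  - move=> v; rewrite subn0 => vU; apply: lookup_glue_notinr.
    by apply/negP => vB; rewrite (disjointFr BU vB) in vU.
  - move=> i u v lt_i euv uU vU.
    have lt_o : (r.*2 - i.+1 < r.*2)%N by clear -lt_i le_j; lia.
    have := agree (Ordinal lt_o, (v, u)); rewrite inE /= e_sym euv vU /=.
    have -> : ((r.*2 - i.+1).+1 = r.*2 - i)%N by clear -lt_i le_j; lia.
    rewrite uU /own /val /phase /own /= => /(_ isT).
    have -> : (r.*2 - i.+1 < r)%N = false by clear -lt_i le_j; lia.
    have -> : (r.*2 - (r.*2 - i.+1).+1 = i)%N by clear -lt_i le_j; lia.
    by apply => //; clear -lt_i le_j; lia.
have knowB w x x' y j : (j <= r)%N ->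
    (forall t, t \in timed_cut U -> own t -> (phase t < j)%N ->
       val w t x y = val w t x' y) ->
    {in ~: U j, forall v, loc x y v = loc x' y v /\
       received e p w (loc x y) j v = received e p w (loc x' y) j v}.
  move=> le_j agree.
  apply: (@received_agree _ _ _ e p w _ _ (fun i => ~: U i) j) => //.
  - by move=> i lt_i; rewrite finset.setCS; apply: Umono; clear -lt_i le_j; lia.
  - move=> v; rewrite inE => vU; apply: lookup_glue_notinl.
    by apply: contra vU; exact: fintype.subsetP.
  - move=> i u v lt_i euv; rewrite !inE negbK => uU vU.
    have lt_o : (i < r.*2)%N by clear -lt_i le_j; lia.
    have := agree (Ordinal lt_o, (u, v)); rewrite inE /= euv uU vU /=.
    rewrite /own /val /phase /own /= => /(_ isT).
    have -> : (i < r)%N by clear -lt_i le_j; lia.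
    by apply => //; clear -lt_i le_j; lia.
have a0U : a0 \in U r.
  by apply: (fintype.subsetP (Umono 0%N r _ _)) (fintype.subsetP AU _ a0A) => //; clear; lia.
have b0U : b0 \in ~: U r.
  rewrite inE; apply/negP => /(fintype.subsetP (Umono r r.*2 _ _)) h.
  by have := disjointFr BU b0B; rewrite h //; clear; lia.
have [p2 p2P] : exists p2 : protocol2 (inputs n A) (inputs n B) W, forall w x y,
    let: (ha, hb) := received2 p2 w x y (size ev) in
    output_alice p2 w x ha = out a0 w x y /\ output_bob p2 w y hb = out b0 w x y.
  apply: (@protocol2_of_events _ _ _ _ ev own val).
  - move=> w x y y' s1 t s2 evE ot agree.
    have tC : t \in timed_cut U by rewrite -mem_ev evE mem_cat mem_head orbT.
    have ltr := ltn_ord t.1; have ot' := ot; rewrite /own in ot'.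
    rewrite /val ot /snd.
    have [||-> -> //] := knowA w x y y' t.1 (ltnW ot) _ t.2.1.
      move=> t' t'C ot1 lt_ph; apply: agree ot1; apply: earlier evE t'C _.
      by apply: leq_trans lt_ph _; rewrite /phase; move: (nat_of_ord t.1) ltr ot'; clear=> j; lia.
    (* The sender lies in [U t.1], and [t.1 <= 2r - t.1] places it in Alice's region at time
       [t.1]. *)
    apply: (fintype.subsetP (Umono t.1 _ _ _)); [move: (nat_of_ord t.1) ltr ot'; clear=> j; lia|exact: leq_subr|].
    by move: tC; rewrite inE => /and3P[].
  - move=> w x x' y s1 t s2 evE ot agree.
    have tC : t \in timed_cut U by rewrite -mem_ev evE mem_cat mem_head orbT.
    have ltr := ltn_ord t.1; have ot' := ot; rewrite /own -leqNgt in ot'.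
    rewrite /val (negPf ot) /snd.
    have [|||-> -> //] := knowB w x x' y (r.*2 - t.1.+1)%N _ _ t.2.2.
    + by move: (nat_of_ord t.1) ltr ot'; clear=> j; lia.
    + move=> t' t'C ot1 lt_ph; apply: agree ot1; apply: earlier evE t'C _.
      by apply: leq_trans lt_ph _; rewrite /phase; move: (nat_of_ord t.1) ltr ot'; clear=> j; lia.
    move: tC; rewrite !inE => /and3P[_ _]; apply: contra.
    by apply: (fintype.subsetP (Umono _ _ _ _)); move: (nat_of_ord t.1) ltr ot'; clear=> j; lia.
  - move=> w x y y' agree; rewrite /out.
    have [||-> -> //] := knowA w x y y' r (leqnn r) _ a0.
      by move=> t tC ot _; apply: agree ot; rewrite mem_ev.
    by have -> : (r.*2 - r = r)%N by clear; lia.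
  - move=> w x x' y agree; rewrite /out.
    have [|//|-> -> //] := knowB w x x' y r (leqnn r) _ b0.
    by move=> t tC ot _; apply: agree ot; rewrite mem_ev.
exists W; exists p2 => x y; apply: le_trans (pP (glue xt x y)).
rewrite /prob big_mkcond [leRHS]big_mkcond /=; apply: ler_sum => w _.
have := p2P w x y; rewrite /correct2 size_sort -cardE.
case: (received2 _ _ _ _ _) => ha hb [-> ->].
case: (boolP (correct _ _ _ _ _ _)) => [/forallP/= cor|_].
  have := cor a0; have := cor b0.
  rewrite (fintype.subsetP AK _ a0A) (fintype.subsetP BK _ b0B) /= => /eqP ob /eqP oa.
  by rewrite /out /loc oa ob !eqxx.
by case: ifP => _ //=; exact: mass_ge0.
Qed.

End CutSimulation.

(** * Routing commodities in rounds *)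

Section Routing.
Variables (R : realType) (V : finType) (e : rel V).

(** [X u c] is the amount of commodity [c] at [u] before the round, [Y] after it. The amount
    [g u u c] stays in place and is not limited, which plays the part of the infinite edges. *)
Definition route_step (I : finType) (X Y : V -> I -> R) : Prop :=
  exists g : V -> V -> I -> R,
  [/\ forall u v c, 0 <= g u v c,
      forall u c, \sum_v g u v c = X u c,
      forall v c, \sum_u g u v c = Y v c &
      forall u v, u != v -> \sum_c g u v c <= (e u v)%:R].

Fixpoint routes (I : finType) (t : nat) (X Y : V -> I -> R) : Prop :=
  if t is t'.+1 then exists Z, route_step X Z /\ routes t' Z Y else X = Y.

Lemma eq_routes (I : finType) t (X X' Y Y' : V -> I -> R) :
  X =2 X' -> Y =2 Y' -> routes t X Y -> routes t X' Y'.
Proof. by move=> /funeq2P <- /funeq2P <-. Qed.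

Lemma routes_cat (I : finType) s t (X Y Z : V -> I -> R) :
  routes s X Y -> routes t Y Z -> routes (s + t) X Z.
Proof.
elim: s X => [|s IH] X /=; first by move=> ->.
by move=> [X1 [st r]] r'; exists X1; split=> //; exact: IH.
Qed.

Lemma routes_rev (I : finType) t (X Y : V -> I -> R) :
  symmetric e -> routes t X Y -> routes t Y X.
Proof.
move=> e_sym; elim: t X => [|t IH] X; first by move=> ->.
move=> [X1 [[g [g0 gX gY gc]] r]]; rewrite -addn1; apply: routes_cat (IH _ r) _.
exists X; split=> //; exists (fun u v => g v u); split=> // u v uv.
by rewrite e_sym gc // eq_sym.
Qed.

Lemma routesP (I : finType) t (X Y : V -> I -> R) :
  routes t X Y <-> exists Z : nat -> V -> I -> R,
    [/\ Z 0%N = X, Z t = Y & forall i, (i < t)%N -> route_step (Z i) (Z i.+1)].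
Proof.
split; elim: t X => [|t IH] X /=.
- by move=> <-; exists (fun=> X).
- move=> [X1 [st /IH[Z [Z0 Zt Zst]]]].
  exists (fun i => if i is i'.+1 then Z i' else X); split=> // -[|i] lt_i.
    by rewrite Z0.
  exact: Zst.
- by move=> [Z [<- <-]].
- move=> [Z [Z0 Zt Zst]]; exists (Z 1%N); split; first by rewrite -Z0; exact: Zst.
  by apply: IH; exists (fun i => Z i.+1); split=> // i lt_i; exact: Zst.
Qed.

Lemma routes_stay (I : finType) t (X Y Z : V -> I -> R) :
  (forall u c, 0 <= Z u c) -> routes t X Y ->
  routes t (fun u c => X u c + Z u c) (fun u c => Y u c + Z u c).
Proof.
move=> Z0; elim: t X => [|t IH] X /=; first by move=> ->.
move=> [X1 [[g [g0 gX gY gc]] r]]; exists (fun u c => X1 u c + Z u c).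
split; last exact: IH.
exists (fun u v c => g u v c + Z u c * (v == u)%:R); split.
- by move=> u v c; rewrite addr_ge0 // mulr_ge0.
- move=> u c; rewrite big_split /= gX (bigD1 u) //= eqxx mulr1 big1 ?addr0 //.
  by move=> v /negPf ->; rewrite mulr0.
- move=> v c; rewrite big_split /= gY (bigD1 v) //= eqxx mulr1 big1 ?addr0 //.
  by move=> u /negPf uv; rewrite eq_sym uv mulr0.
- move=> u v uv; apply: le_trans (gc u v uv); apply: ler_sum => c _.
  by rewrite eq_sym (negPf uv) mulr0 addr0.
Qed.

Lemma routes_mid (I : finType) t (X Y X' Y' : V -> I -> R) :
  routes t X Y -> routes t X' Y' ->
  routes t (fun u c => (X u c + X' u c) / 2) (fun u c => (Y u c + Y' u c) / 2).
Proof.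
elim: t X X' => [|t IH] X X' /=; first by move=> -> ->.
move=> [X1 [[g [g0 gX gY gc]] r]] [X2 [[g' [g0' gX' gY' gc']] r']].
exists (fun u c => (X1 u c + X2 u c) / 2); split; last exact: IH.
exists (fun u v c => (g u v c + g' u v c) / 2); split.
- by move=> u v c; rewrite divr_ge0 // addr_ge0.
- by move=> u c; rewrite -mulr_suml big_split /= gX gX'.
- by move=> u c; rewrite -mulr_suml big_split /= gY gY'.
- move=> u v uv; rewrite -mulr_suml big_split /=.
  have := gc u v uv; have := gc' u v uv; lra.
Qed.

(** A unit of [i] is treated as a parcel containing [L i j] of each [j]. Contents of total at most
    one per parcel respect the capacities. *)
Lemma routes_recode (I J : finType) t (L : I -> J -> R) (X Y : V -> I -> R) :
  (forall i j, 0 <= L i j) -> (forall i, \sum_j L i j <= 1) ->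
  routes t X Y ->
  routes t (fun u j => \sum_i X u i * L i j) (fun u j => \sum_i Y u i * L i j).
Proof.
move=> L0 L1; elim: t X => [|t IH] X /=; first by move=> ->.
move=> [X1 [[g [g0 gX gY gc]] r]]; exists (fun u j => \sum_i X1 u i * L i j).
split; last exact: IH.
exists (fun u v j => \sum_i g u v i * L i j); split.
- by move=> u v j; apply: sumr_ge0 => i _; rewrite mulr_ge0.
- move=> u j; rewrite exchange_big /=; apply: eq_bigr => i _.
  by rewrite -gX mulr_suml.
- move=> u j; rewrite exchange_big /=; apply: eq_bigr => i _.
  by rewrite -gY mulr_suml.
- move=> u v uv; rewrite exchange_big /=; apply: le_trans (gc u v uv).
  apply: ler_sum => i _; rewrite -mulr_sumr -[leRHS]mulr1.
  exact: ler_wpM2l.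
Qed.

(** The copies travel one after another; those not on their way wait at their start or their
    destination. Time thus buys volume. *)
Lemma routes_repeat (I : finType) t j (X Y : V -> I -> R) :
  (forall u c, 0 <= X u c) -> (forall u c, 0 <= Y u c) -> routes t X Y ->
  routes (j * t) (fun u c => X u c *+ j) (fun u c => Y u c *+ j).
Proof.
move=> X0 Y0 r; elim: j => [|j IH]; first by apply/funext => u; apply/funext.
rewrite mulSn; apply: (@routes_cat _ _ _ _ (fun u c => Y u c + X u c *+ j)).
  apply: eq_routes (routes_stay (Z := fun u c => X u c *+ j) _ r).
  - by move=> u c; rewrite mulrS.
  - by [].
  - by move=> u c; rewrite mulrn_wge0.
apply: eq_routes (routes_stay (Z := Y) Y0 IH) => u c; first by rewrite addrC.
by rewrite mulrSr.
Qed.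

Lemma sum_delta (T : finType) (F : T -> R) (b : T) : \sum_a F a * (b == a)%:R = F b.
Proof.
rewrite (bigD1 b) //= eqxx mulr1 big1 ?addr0 // => a /negPf ab.
by rewrite eq_sym ab mulr0.
Qed.

Lemma sum_triple (I : finType) (F : V -> V -> I -> R) :
  \sum_(p : V * V * I) F p.1.1 p.1.2 p.2 = \sum_a \sum_b \sum_c F a b c.
Proof.
rewrite pair_bigA (pair_bigA _ (fun p c => F p.1 p.2 c)).
by apply: eq_bigr => -[[a b] c].
Qed.

(** Since [s / s] is [0] at [s = 0], the point is that a vanishing sum of nonnegative terms has
    vanishing terms. *)
Lemma div_id_dominated (T : finType) (F : T -> R) (s : R) i :
  (forall j, 0 <= F j) -> \sum_j F j = s -> F i * (s / s) = F i.
Proof.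
move=> F0 sE; have [s0|s0] := eqVneq s 0; last by rewrite divff // mulr1.
have : F i <= s by rewrite -sE (bigD1 i) //= lerDl sumr_ge0.
by rewrite s0 => Fi; have /eqP -> : F i == 0; rewrite ?mul0r // eq_le Fi F0.
Qed.

(* If a round brings [g u v c] to [v], which then holds [X1 v c], then [u]
   accounts for the fraction [g u v c / X1 v c] of whatever later leaves [v]. *)
Lemma routes_pairs (I : finType) t (X Y : V -> I -> R) :
  (forall u c, 0 <= X u c) -> routes t X Y ->
  exists w : V -> V -> I -> R,
  [/\ forall a b c, 0 <= w a b c,
      forall a c, \sum_b w a b c = X a c,
      forall b c, \sum_a w a b c = Y b c &
      routes t (fun u (p : V * V * I) => w p.1.1 p.1.2 p.2 * (u == p.1.1)%:R)
               (fun u (p : V * V * I) => w p.1.1 p.1.2 p.2 * (u == p.1.2)%:R)].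
Proof.
elim: t X => [|t IH] X X0 /=.
  move=> <-; exists (fun a b c => X a c * (a == b)%:R); split.
  - by move=> a b c; rewrite mulr_ge0.
  - by move=> a c; rewrite (sum_delta (fun=> X a c)).
  - move=> b c; under eq_bigr do rewrite eq_sym.
    by rewrite (sum_delta (fun a => X a c)).
  - apply/funext => u; apply/funext => -[[a b] c] /=.
    by case: (a =P b) => [->//|]; rewrite mulr0 !mul0r.
move=> [X1 [[g [g0 gX gX1 gc]] r]].
have X10 v c : 0 <= X1 v c by rewrite -gX1 sumr_ge0.
have [w1 [w10 w1X w1Y w1r]] := IH X1 X10 r.
have gdiv u v c : g u v c * (X1 v c / X1 v c) = g u v c.
  by apply: (@div_id_dominated _ (fun u => g u v c)).
have wdiv v b c : w1 v b c * (X1 v c / X1 v c) = w1 v b c.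
  by apply: (@div_id_dominated _ (fun b => w1 v b c)).
pose h a v b c := g a v c * w1 v b c / X1 v c.
have h0 a v b c : 0 <= h a v b c by rewrite divr_ge0 // mulr_ge0.
have hb a v c : \sum_b h a v b c = g a v c.
  by rewrite -mulr_suml -mulr_sumr w1X -mulrA gdiv.
have ha v b c : \sum_a h a v b c = w1 v b c.
  rewrite -mulr_suml -mulr_suml gX1 -[RHS]wdiv; ring.
exists (fun a b c => \sum_v h a v b c); split.
- by move=> a b c; apply: sumr_ge0.
- by move=> a c; rewrite exchange_big /= -gX; apply: eq_bigr => v _; exact: hb.
- move=> b c; rewrite exchange_big /= -w1Y; apply: eq_bigr => v _; exact: ha.
exists (fun u p => h p.1.1 u p.1.2 p.2); split.
  exists (fun u v p => h p.1.1 v p.1.2 p.2 * (u == p.1.1)%:R); split.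
  - by move=> u v p; rewrite mulr_ge0.
  - by move=> u p; rewrite mulr_suml.
  - move=> v p; under eq_bigr do rewrite eq_sym.
    by rewrite (sum_delta (fun=> h p.1.1 v p.1.2 p.2)).
  - move=> u v uv; rewrite (sum_triple (fun a b c => h a v b c * (u == a)%:R)).
    rewrite exchange_big /= .
    under eq_bigr do under eq_bigr do rewrite -mulr_suml.
    under eq_bigr do rewrite sum_delta.
    rewrite exchange_big /=; under eq_bigr do rewrite hb.
    exact: gc.
(* The remaining rounds route triples [(v, b, c)]. Each is split into triples [(a, b, c)] in
   proportion to what [a] sent to [v] in the first round. *)
pose L (p q : V * V * I) := g q.1.1 p.1.1 p.2 / X1 p.1.1 p.2 *
  ((q.1.2 == p.1.2)%:R * (q.2 == p.2)%:R).
have LE u q (G : V -> V -> V -> R) :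
    \sum_p w1 p.1.1 p.1.2 p.2 * G u p.1.1 p.1.2 * L p q =
    \sum_v h q.1.1 v q.1.2 q.2 * G u v q.1.2.
  pose F a b c := w1 a b c * G u a b * (g q.1.1 a c / X1 a c) *
    (q.1.2 == b)%:R * (q.2 == c)%:R.
  transitivity (\sum_p F p.1.1 p.1.2 p.2).
    by apply: eq_bigr => p _; rewrite /F /L; ring.
  rewrite sum_triple; apply: eq_bigr => a _; rewrite /F.
  under eq_bigr do rewrite sum_delta.
  by rewrite sum_delta /h; ring.
apply: eq_routes (routes_recode (L := L) _ _ w1r).
- move=> u q; rewrite (LE u q (fun u a b => (u == a)%:R)).
  by rewrite sum_delta.
- by move=> u q; rewrite (LE u q (fun u a b => (u == b)%:R)) mulr_suml.
- by move=> p q; rewrite mulr_ge0 ?divr_ge0 ?mulr_ge0.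
move=> p; rewrite /L.
rewrite (sum_triple (fun a b c => g a p.1.1 p.2 / X1 p.1.1 p.2 *
  ((b == p.1.2)%:R * (c == p.2)%:R))).
have dl (T : finType) (x : T) : \sum_y (y == x)%:R = 1 :> R.
  by rewrite (bigD1 x) //= eqxx big1 ?addr0 // => y /negPf ->.
under eq_bigr do under eq_bigr do rewrite -mulr_sumr -mulr_sumr dl mulr1.
under eq_bigr do rewrite -mulr_sumr dl mulr1.
rewrite -mulr_suml gX1; have [->|s0] := eqVneq (X1 p.1.1 p.2) 0.
  by rewrite mul0r.
by rewrite divff.
Qed.

(** The commodities are the ordered pairs, and round [i] of the routing is the flow from layer [i]
    to layer [i.+1]. At an inner layer [Z i] enters and leaves; only the first and last layers have
    a net outflow. *)
Lemma mcf_of_routes (K : {set V}) t (d : R) :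
  routes t (fun u (p : V * V) => d * ((p.1 \in K) && (p.2 \in K))%:R * (u == p.1)%:R)
           (fun u (p : V * V) => d * ((p.1 \in K) && (p.2 \in K))%:R * (u == p.2)%:R) ->
  mcf_feasible e t K d.
Proof.
move=> /routesP[Z [Z0 Zt st]].
have /choice [g gP] : forall i : nat, exists g : V -> V -> V * V -> R, (i < t)%N ->
  [/\ forall u v c, 0 <= g u v c,
      forall u c, \sum_v g u v c = Z i u c,
      forall v c, \sum_u g u v c = Z i.+1 v c &
      forall u v, u != v -> \sum_c g u v c <= (e u v)%:R].
  move=> i; have [lt_i|ge_i] := ltnP i t; last by exists (fun _ _ _ => 0).
  by have [h hP] := st i lt_i; exists h.
pose phi u v (a b : timed_vertex V t) :=
  if b.2 == a.2.+1 :> nat then g a.2 a.1 b.1 (u, v) else 0.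
have lt_phi (a b : timed_vertex V t) : b.2 = a.2.+1 :> nat -> (a.2 < t)%N.
  by move=> E; have := ltn_ord b.2; rewrite E ltnS.
exists phi; split=> [u v uK vK|a b].
  split=> [a b|[x i]].
    rewrite /phi; case: eqP => // /lt_phi/gP[g0 _ _ _]; exact: g0.
  have -> : \sum_b phi u v (x, i) b = if (i < t)%N then Z i x (u, v) else 0.
    rewrite -(pair_bigA _ (fun y j => phi u v (x, i) (y, j))) exchange_big /=.
    case: ifP => [lt_i|ge_i].
      have lt_i1 : (i.+1 < t.+1)%N by [].
      rewrite (bigD1 (Ordinal lt_i1)) //= [X in _ + X]big1 ?addr0.
        by have [_ <- _ _] := gP i lt_i; apply: eq_bigr => y _; rewrite /phi /= eqxx.
      move=> j jE; rewrite big1 // => y _; rewrite /phi /=; case: eqP => // E.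
      by case/eqP: jE; apply: val_inj.
    rewrite big1 // => j _; rewrite big1 // => y _; rewrite /phi /=; case: eqP => // E.
    by have := ltn_ord j; rewrite E ltnS ge_i.
  have -> : \sum_b phi u v b (x, i) = if (0 < i)%N then Z i x (u, v) else 0.
    rewrite -(pair_bigA _ (fun y j => phi u v (y, j) (x, i))) exchange_big /=.
    case: i => -[|i] lt_i /=.
      by rewrite big1 // => j _; rewrite big1.
    have lt_i1 : (i < t.+1)%N by exact: ltnW.
    rewrite (bigD1 (Ordinal lt_i1)) //= [X in _ + X]big1 ?addr0.
      by have [_ _ <- _] := gP i lt_i; apply: eq_bigr => y _; rewrite /phi /= eqxx.
    move=> j jE; rewrite big1 // => y _; rewrite /phi /=; case: eqP => // -[E].
    by case/eqP: jE; apply: val_inj.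
  have ZS : Z 0%N x (u, v) = d *+ (x == u).
    by rewrite Z0 /= uK vK mulr1 mulr_natr.
  have ZD : Z t x (u, v) = d *+ (x == v).
    by rewrite Zt /= uK vK mulr1 mulr_natr.
  rewrite !xpair_eqE -!val_eqE /=.
  have [it|] := ltnP i t; have [i0|] := posnP i.
  - by rewrite (ltn_eqF it) i0 ZS ?eqxx andbT andbF mulr0n !subr0.
  - by move=> i0; rewrite ?(gtn_eqF i0) (ltn_eqF it) !andbF !mulr0n !subrr.
  (* For [t = 0] the first and last layers coincide, and supply and demand cancel because both are
     [Z 0]. *)
  - rewrite i0 leqn0 => /eqP t0; rewrite t0 ?eqxx !andbT.
    by rewrite -ZS -ZD t0 !subrr.
  - move=> i0 ti; have it : nat_of_ord i = t by apply/eqP; rewrite eqn_leq ti -ltnS ltn_ord.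
    rewrite it in i0 *; rewrite ?(gtn_eqF i0).
    by rewrite ZD ?eqxx andbT andbF mulr0n.
rewrite /capacity; have [E|NE] /= := eqVneq (nat_of_ord b.2) a.2.+1; last first.
  rewrite big1 // => u _; rewrite big1 // => v _.
  by rewrite /phi (negPf NE).
case: eqP => [_|/eqP ab]; first by rewrite leey.
have [g0 _ _ gc] := gP _ (lt_phi _ _ E).
have le_g : \sum_(u in K) \sum_(v in K) phi u v a b <= \sum_c g a.2 a.1 b.1 c.
  rewrite pair_big_dep /= [leLHS]big_mkcond; apply: ler_sum => -[u v] _ /=.
  by case: ifP => // _; rewrite /phi E eqxx.
have := le_trans le_g (gc _ _ ab).
by case: (e _ _) => le1; rewrite lee_fin.
Qed.

End Routing.

(** * Random signs *)

Section RandomSigns.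
Variable R : realType.

Lemma jensen_sqr (T : finType) (P : pred T) (w x : T -> R) :
  (forall i, P i -> 0 <= w i) -> \sum_(i | P i) w i = 1 ->
  (\sum_(i | P i) w i * x i) ^+ 2 <= \sum_(i | P i) w i * x i ^+ 2.
Proof.
move=> w0 w1; set m := \sum_(i | P i) w i * x i.
rewrite -subr_ge0; have -> : \sum_(i | P i) w i * x i ^+ 2 - m ^+ 2 =
    \sum_(i | P i) w i * (x i - m) ^+ 2.
  transitivity (\sum_(i | P i) (w i * x i ^+ 2 - 2 * m * (w i * x i) + m ^+ 2 * w i)).
    by rewrite big_split sumrB -!mulr_sumr w1 -/m /=; ring.
  by apply: eq_bigr => i _; ring.
by apply: sumr_ge0 => i Pi; rewrite mulr_ge0 ?sqr_ge0 ?w0.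
Qed.

(** [expR y] is at most [1 / (1 - y)], and [(1 - y) * (1 + y + 2 * y ^+ 2) = 1 + y ^+ 2 * (1 - 2 *
    y)], which is at least [1]. *)
Lemma expR_le_quad (y : R) : y <= 1 / 2 -> expR y <= 1 + y + 2 * y ^+ 2.
Proof.
move=> y2; have : 1 - y <= expR (- y) by exact: expR_ge1Dx.
rewrite expRN => h; have e0 := expR_gt0 y.
have : expR y * (1 - y) <= 1 by rewrite -ler_pdivlMl ?mulr1.
nra.
Qed.

Lemma expR_half_le2 : expR (1 / 2) <= 2 :> R.
Proof. by apply: le_trans (expR_le_quad _) _; lra. Qed.

Variable T : finType.
Implicit Types (z : {ffun T -> bool}) (v : T -> R).

Definition sgn (b : bool) : R := if b then 1 else -1.
Definition signed_sum z v : R := \sum_c sgn (z c) * v c.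

Lemma sgn_sqr b : sgn b ^+ 2 = 1.
Proof. by case: b; rewrite /sgn ?expr1n ?sqrrN ?expr1n. Qed.

Lemma signed_sumZ z v a : signed_sum z (fun c => a * v c) = a * signed_sum z v.
Proof. by rewrite /signed_sum mulr_sumr; apply: eq_bigr => c _; rewrite mulrCA. Qed.

Lemma signed_sumB z v v' :
  signed_sum z (fun c => v c - v' c) = signed_sum z v - signed_sum z v'.
Proof. by rewrite /signed_sum -sumrB; apply: eq_bigr => c _; rewrite mulrBr. Qed.

Lemma signed_sum_sqr_le z v : signed_sum z v ^+ 2 <= #|T|%:R * \sum_c v c ^+ 2.
Proof.
have [T0|T0] := posnP #|T|.
  by rewrite /signed_sum !big_pred0 ?mulr0 ?expr0n // => c;
    have := fintype0 c T0.
have T0' : #|T|%:R != 0 :> R by rewrite pnatr_eq0 -lt0n.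
have w1 : \sum_(c : T) #|T|%:R^-1 = 1 :> R.
  by rewrite sumr_const -[_ *+ _]mulr_natl; exact: mulfV.
have w0 (c : T) : true -> 0 <= #|T|%:R^-1 :> R by rewrite invr_ge0.
have := jensen_sqr (fun c => sgn (z c) * v c) w0 w1.
rewrite -!mulr_sumr -/(signed_sum z v) exprMn.
under [in leRHS]eq_bigr do rewrite exprMn sgn_sqr mul1r.
have T1 : 0 < #|T|%:R :> R by rewrite ltr0n.
by rewrite expr2 -mulrA ler_pM2l ?invr_gt0 // ler_pdivrMl.
Qed.

(** The second moment of the projection: the cross terms cancel, since flipping one sign negates
    them. *)
Lemma sum_signed_sum_sqr v :
  \sum_z signed_sum z v ^+ 2 = #|{ffun T -> bool}|%:R * \sum_c v c ^+ 2.
Proof.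
under eq_bigr do rewrite expr2 /signed_sum big_distrlr /=.
rewrite exchange_big mulr_sumr /=; apply: eq_bigr => c _.
rewrite exchange_big (bigD1 c) //= [X in _ + X]big1 ?addr0.
  under eq_bigr do rewrite -expr2 exprMn sgn_sqr mul1r.
  by rewrite sumr_const mulr_natl.
move=> d dc; set s := LHS; suff : s = - s by lra.
pose flip z := [ffun x => (x == c) (+) z x].
have flipK : involutive flip.
  by move=> z; apply/ffunP => x; rewrite !ffunE addbA addbb.
rewrite {1}/s (reindex_inj (inv_inj flipK)) -sumrN; apply: eq_bigr => z _.
rewrite !ffunE eqxx (negPf dc) /=; case: (z c); rewrite /sgn /=; ring.
Qed.

(** Independence of the signs turns the sum into a product, with factors [expR (v c) + expR (- v c)
    <= 2 + 4 * v c ^+ 2 <= 2 * expR (2 * v c ^+ 2)]. *)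
Lemma sum_expR_signed_sum v : (forall c, `|v c| <= 1 / 2) ->
  \sum_z expR (signed_sum z v) <=
  #|{ffun T -> bool}|%:R * expR (2 * \sum_c v c ^+ 2).
Proof.
move=> v2.
have -> : \sum_z expR (signed_sum z v) = \prod_c (expR (v c) + expR (- v c)).
  under [RHS]eq_bigr => c _.
    rewrite (_ : _ + _ = \sum_b expR (sgn b * v c)); last first.
      by rewrite big_bool /= mul1r mulN1r.
    over.
  rewrite bigA_distr_bigA; apply: eq_bigr => z _.
  by rewrite /signed_sum expR_sum.
rewrite card_ffun card_bool natrX -prodr_const mulr_sumr expR_sum -big_split /=.
apply: ler_prod => c _; rewrite addr_ge0 ?expR_ge0 //=.
have := v2 c; rewrite ler_norml => /andP[v2l v2r].
have := expR_le_quad v2r; have : - v c <= 1 / 2 by lra.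
move/expR_le_quad; have := expR_ge1Dx (2 * v c ^+ 2).
rewrite sqrrN; lra.
Qed.

(* The normalisation puts the coefficients in the range where the quadratic
   bound on [expR] applies; if all of [v] vanishes, so does the quotient. *)
Lemma sum_expR_normalized v :
  \sum_z expR (signed_sum z v / (2 * Num.sqrt (\sum_c v c ^+ 2))) <=
  2 * #|{ffun T -> bool}|%:R.
Proof.
set s := Num.sqrt _; have s0 : 0 <= s by exact: sqrtr_ge0.
have v0 : 0 <= \sum_c v c ^+ 2 by apply: sumr_ge0 => c _; exact: sqr_ge0.
have s2 : s ^+ 2 = \sum_c v c ^+ 2 by rewrite sqr_sqrtr.
pose y c := (2 * s)^-1 * v c.
have y2 : \sum_c y c ^+ 2 <= 1 / 4.
  under eq_bigr do rewrite exprMn.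
  rewrite -mulr_sumr -s2; have [->|sn0] := eqVneq s 0.
    by rewrite expr0n mulr0; lra.
  by rewrite exprVn exprMn invfM -mulrA mulVf ?expf_neq0 // mulr1; lra.
under eq_bigr => z _ do rewrite mulrC -signed_sumZ -/y.
apply: le_trans (sum_expR_signed_sum _) _.
  move=> c; have : y c ^+ 2 <= 1 / 4.
    apply: le_trans y2; rewrite (bigD1 c) //= lerDl.
    by apply: sumr_ge0 => d _; exact: sqr_ge0.
  by rewrite ler_norml; nra.
rewrite mulrC ler_wpM2r //; apply: le_trans expR_half_le2.
rewrite ler_expR; lra.
Qed.

Lemma exists_ge_mean (S : finType) (F : S -> R) (m : R) (s0 : S) :
  #|S|%:R * m <= \sum_s F s -> exists s, m <= F s.
Proof.
move=> mF; apply: contrapT => /forallNP lt_m.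
have : \sum_s F s < \sum_(s : S) m.
  apply: ltr_sum => [|s _]; first by apply/hasP; exists s0; rewrite ?mem_index_enum.
  by rewrite ltNge; apply/negP; exact: lt_m.
by rewrite sumr_const -mulr_natl ltNge mF.
Qed.

(** A single sign vector must keep half of the mean square and stretch no difference by more than
    [2 * t]. Averaging the square minus a penalty for large exponential moments yields both at
    once. *)
Lemma exists_projection (V : finType) (K : {set V}) (p : V -> T -> R) (t : R) :
  4 * #|T|%:R * #|K|%:R ^+ 2 <= expR t ->
  exists z, (\sum_(u in K) \sum_c p u c ^+ 2) / 2 <=
              \sum_(u in K) signed_sum z (p u) ^+ 2 /\
    forall a b, a \in K -> b \in K ->
      (signed_sum z (p a) - signed_sum z (p b)) ^+ 2 <=
      4 * t ^+ 2 * \sum_c (p a c - p b c) ^+ 2.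
Proof.
move=> tbig; set Phi := \sum_(u in K) _.
have Phi0 : 0 <= Phi.
  by apply: sumr_ge0 => u _; apply: sumr_ge0 => c _; exact: sqr_ge0.
have [Phi_eq0|Phi_neq0] := eqVneq Phi 0.
  have p0 u c : u \in K -> p u c = 0.
    move=> uK; move/eqP: Phi_eq0; rewrite psumr_eq0; last first.
      by move=> v _; apply: sumr_ge0 => d _; exact: sqr_ge0.
    move=> /allP/(_ u (mem_index_enum u)); rewrite uK /= psumr_eq0; last first.
      by move=> d _; exact: sqr_ge0.
    by move=> /allP/(_ c (mem_index_enum c)); rewrite /= sqrf_eq0 => /eqP.
  have s0 u z : u \in K -> signed_sum z (p u) = 0.
    by move=> uK; rewrite /signed_sum big1 // => c _; rewrite p0 ?mulr0.
  exists [ffun=> true]; split=> [|a b aK bK].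
    by rewrite Phi_eq0 mul0r sumr_ge0 // => u _; exact: sqr_ge0.
  rewrite !s0 // subrr expr0n /=; apply: mulr_ge0.
    by apply: mulr_ge0 => //; exact: sqr_ge0.
  by apply: sumr_ge0 => c _; exact: sqr_ge0.
have Phi_gt0 : 0 < Phi by rewrite lt_def Phi_neq0.
pose nrm a b := Num.sqrt (\sum_c (p a c - p b c) ^+ 2).
pose ex z a b := expR (signed_sum z (fun c => p a c - p b c) / (2 * nrm a b)).
have ex0 z a b : 0 <= ex z a b by exact: expR_ge0.
(* The first sum never exceeds [#|T|%:R * Phi], so a positive [G z] forces every [ex z a b] below
   [expR t]. By the hypothesis on [t] the penalty averages to at most [Phi / 2]. *)
pose G z := \sum_(u in K) signed_sum z (p u) ^+ 2 -
  #|T|%:R * Phi * expR (- t) * \sum_(a in K) \sum_(b in K) ex z a b.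
have cT_ge0 : 0 <= #|T|%:R * Phi * expR (- t).
  by apply: mulr_ge0; [apply: mulr_ge0|exact: expR_ge0].
have exs0 z : 0 <= \sum_(a in K) \sum_(b in K) ex z a b.
  by apply: sumr_ge0 => a _; apply: sumr_ge0.
have [z Gz] : exists z, Phi / 2 <= G z.
  apply: (exists_ge_mean [ffun=> true]); rewrite /G sumrB.
  rewrite -mulr_sumr [X in X - _]exchange_big /=.
  under eq_bigr do rewrite sum_signed_sum_sqr.
  rewrite -mulr_sumr -/Phi exchange_big /=.
  set N := #|{ffun _ -> _}|%:R.
  have exN : \sum_(a in K) \sum_z \sum_(b in K) ex z a b <= #|K|%:R ^+ 2 * (2 * N).
    apply: (@le_trans _ _ (\sum_(a in K) \sum_(b in K) (2 * N))).
      apply: ler_sum => a _; rewrite exchange_big /=; apply: ler_sum => b _.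
      exact: (sum_expR_normalized (fun c => p a c - p b c)).
    have sumK (x : R) : \sum_(a in K) x = #|K|%:R * x by rewrite sumr_const mulr_natl.
    by under eq_bigr do rewrite sumK; rewrite sumK mulrA -expr2.
  have := ler_wpM2l cT_ge0 exN.
  have : 4 * #|T|%:R * #|K|%:R ^+ 2 * expR (- t) <= 1.
    by rewrite expRN ler_pdivrMr ?expR_gt0 // mul1r.
  have N0 : 0 <= N * Phi by rewrite mulr_ge0.
  move=> h1 h2; have := ler_wpM2r N0 h1; lra.
have le_S : \sum_(u in K) signed_sum z (p u) ^+ 2 <= #|T|%:R * Phi.
  by rewrite mulr_sumr; apply: ler_sum => u _; exact: signed_sum_sqr_le.
have ex_le a b : a \in K -> b \in K -> ex z a b <= expR t.
  move=> aK bK.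
  have exs : ex z a b <= \sum_(a in K) \sum_(b in K) ex z a b.
    rewrite (bigD1 a) //= (bigD1 b) //= -addrA lerDl addr_ge0 //.
      by apply: sumr_ge0.
    by apply: sumr_ge0 => c _; apply: sumr_ge0.
  have T0 : 0 < #|T|%:R * Phi.
    apply: lt_le_trans le_S; have := mulr_ge0 (cT_ge0) (exs0 z).
    by move: Gz; rewrite /G; lra.
  have : #|T|%:R * Phi * (expR (- t) * ex z a b) <= #|T|%:R * Phi * 1.
    have := ler_wpM2l (ltW T0) (ler_wpM2l (expR_ge0 (- t)) exs).
    by move: Gz; rewrite /G; lra.
  by rewrite ler_pM2l // mulrC expRN ler_pdivrMr ?expR_gt0 // mul1r.
have proj_le a b : a \in K -> b \in K ->
    signed_sum z (p a) - signed_sum z (p b) <= 2 * t * nrm a b.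
  move=> aK bK; have := ex_le a b aK bK; rewrite /ex ler_expR.
  have := sqrtr_ge0 (\sum_c (p a c - p b c) ^+ 2).
  rewrite -/(nrm a b) le_eqVlt => /predU1P[nE|n0].
    have v0 c : p a c - p b c = 0.
      move/esym/eqP: nE; rewrite sqrtr_eq0 => h.
      have : \sum_c (p a c - p b c) ^+ 2 == 0.
        by rewrite eq_le h sumr_ge0 // => d _; exact: sqr_ge0.
      rewrite psumr_eq0; last by move=> d _; exact: sqr_ge0.
      by move=> /allP/(_ c (mem_index_enum c)); rewrite /= sqrf_eq0 => /eqP.
    by rewrite -signed_sumB /signed_sum big1 -?nE ?mulr0 // => c _; rewrite v0 mulr0.
  by rewrite ler_pdivrMr ?mulr_gt0 // signed_sumB; lra.
exists z; split=> [|a b aK bK].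
  by apply: le_trans Gz _; rewrite /G lerBlDr lerDl; exact: mulr_ge0.
have s2 : nrm a b ^+ 2 = \sum_c (p a c - p b c) ^+ 2.
  by rewrite sqr_sqrtr // sumr_ge0 // => c _; exact: sqr_ge0.
have := proj_le a b aK bK; have := proj_le b a bK aK.
have -> : nrm b a = nrm a b.
  by congr Num.sqrt; apply: eq_bigr => c _; rewrite -sqrrN opprB.
rewrite -s2; set d := signed_sum z (p a) - _ => h1 h2.
have -> : 4 * t ^+ 2 * nrm a b ^+ 2 = (2 * t * nrm a b) ^+ 2 by ring.
rewrite -[leLHS]real_normK ?num_real // ler_sqr ?nnegrE //.
  by rewrite ler_norml h2 andbT lerNl opprB.
by move: h1 h2; rewrite /d; lra.
Qed.

End RandomSigns.

(** * Bisections and the potential *)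

Section CutMatching.
Variables (R : realType) (V : finType) (K : {set V}).

Lemma exists_lower_set (x : V -> R) j : (j <= #|K|)%N ->
  exists A : {set V}, [/\ A \subset K, #|A| = j &
    forall a b, a \in A -> b \in K -> b \notin A -> x a <= x b].
Proof.
elim: j => [|j IH] lt_j; first by exists finset.set0;
  rewrite finset.sub0set cards0; split=> // a b; rewrite inE.
have [A [AK Aj Ax]] := IH (ltnW lt_j).
have /card_gt0P[b0 b0KA] : (0 < #|K :\: A|)%N.
  by rewrite cardsD (finset.setIidPr AK) Aj subn_gt0.
case: (@arg_minP _ _ _ b0 (mem (K :\: A)) x b0KA) => b bKA bmin.
have /setDP[bK bA] : b \in K :\: A by [].
exists (b |: A); split; first by rewrite finset.subUset finset.sub1set bK.
  by rewrite cardsU1 bA Aj.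
move=> a c; rewrite !inE negb_or => /orP[/eqP ->|aA] cK /andP[cb cA]; last exact: Ax.
by apply: bmin; apply/setDP.
Qed.

Definition potential (p : V -> V -> R) : R := \sum_(u in K) \sum_c p u c ^+ 2.

Definition mix (M p : V -> V -> R) (u c : V) : R :=
  (p u c + \sum_(v in K) M u v * p v c) / 2.

(** A fractional perfect matching between [A] and the rest of [K], kept as a symmetric doubly
    stochastic matrix on [K]. *)
Definition cross_matching (A : {set V}) (M : V -> V -> R) : Prop :=
  [/\ forall u v, 0 <= M u v,
      forall u v, M u v = M v u,
      forall u, u \in K -> \sum_(v in K) M u v = 1 &
      forall u v, M u v != 0 -> [/\ u \in K, v \in K & (u \in A) != (v \in A)]].

Lemma sum_matching_sym A M (F : V -> R) : cross_matching A M ->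
  \sum_(u in K) \sum_(v in K) M u v * F v = \sum_(u in K) F u.
Proof.
case=> _ Msym M1 _; rewrite exchange_big /=; apply: eq_bigr => v vK.
by rewrite -mulr_suml; under eq_bigr do rewrite Msym; rewrite M1 // mul1r.
Qed.

Lemma sum_matching A M (F : V -> R) : cross_matching A M ->
  \sum_(u in K) \sum_(v in K) M u v * F u = \sum_(u in K) F u.
Proof.
by case=> _ _ M1 _; apply: eq_bigr => v vK; rewrite -mulr_suml M1 // mul1r.
Qed.

(** Row [u] of the mixture is the [M]-average of the midpoints [(p u + p v) / 2]. Convexity of the
    square and [((a + b) / 2) ^+ 2 = a ^+ 2 / 2 + b ^+ 2 / 2 - (a - b) ^+ 2 / 4] give the bound;
    double stochasticity sums the first two terms to the old potential. *)
Lemma mix_potential A M p : cross_matching A M ->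
  potential (mix M p) <= potential p -
    (\sum_(u in K) \sum_(v in K) M u v * \sum_c (p u c - p v c) ^+ 2) / 4.
Proof.
move=> MA; have [M0 Msym M1 _] := MA.
pose F u v := \sum_c (p u c ^+ 2 / 2 + p v c ^+ 2 / 2 - (p u c - p v c) ^+ 2 / 4).
apply: (@le_trans _ _ (\sum_(u in K) \sum_(v in K) M u v * F u v)).
  apply: ler_sum => u uK.
  apply: (@le_trans _ _ (\sum_c \sum_(v in K) M u v * ((p u c + p v c) / 2) ^+ 2)).
    apply: ler_sum => c _.
    have := @jensen_sqr R V (mem K) (M u) (fun v => (p u c + p v c) / 2)
      (fun v _ => M0 u v) (M1 u uK).
    rewrite (_ : \sum_(v in K) _ = mix M p u c) //.
    rewrite /mix -[p u c in RHS]mul1r -(M1 u uK) mulr_suml -big_split /= mulr_suml.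
    by apply: eq_bigr => v _; ring.
  rewrite exchange_big /=; apply: ler_sum => v vK; rewrite -mulr_sumr ler_wpM2l //.
  by apply: ler_sum => c _; lra.
rewrite le_eqVlt; apply/orP; left; apply/eqP.
transitivity (\sum_(u in K) \sum_(v in K) (M u v * ((\sum_c p u c ^+ 2) / 2) +
    M u v * ((\sum_c p v c ^+ 2) / 2) - (M u v * \sum_c (p u c - p v c) ^+ 2) / 4)).
  apply: eq_bigr => u _; apply: eq_bigr => v _.
  by rewrite /F big_split /= sumrN big_split /= -!mulr_suml; ring.
under eq_bigr do rewrite sumrB big_split /=.
rewrite sumrB big_split /=; congr (_ - _); last first.
  by rewrite mulr_suml; apply: eq_bigr => u _; rewrite mulr_suml.
rewrite (sum_matching (fun u => (\sum_c p u c ^+ 2) / 2) MA).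
rewrite (sum_matching_sym (fun u => (\sum_c p u c ^+ 2) / 2) MA).
by rewrite -mulr_suml /potential; lra.
Qed.

(* Bisect at the median of a random one-dimensional projection [x]: across the
   median [eta], [(x u - x v)^2 >= (x u - eta)^2 + (x v - eta)^2]. *)
Lemma exists_bisection (p : V -> V -> R) (t : R) :
  (0 < #|K|./2)%N -> (forall c, \sum_(u in K) p u c = 0) ->
  4 * #|V|%:R * #|K|%:R ^+ 2 <= expR t ->
  exists A : {set V}, [/\ A \subset K, #|A| = #|K|./2 &
    forall M, cross_matching A M ->
      potential p <= 4 * t ^+ 2 *
        \sum_(u in K) \sum_(v in K) M u v * \sum_c (p u c - p v c) ^+ 2].
Proof.
move=> K2 p0 tbig; have [z [zbig zle]] := exists_projection p tbig.
pose x u := signed_sum z (p u).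
have [|A [AK Ahalf Ax]] := @exists_lower_set x #|K|./2; first by lia.
exists A; split=> // M MA; have [M0 Msym M1 Mcross] := MA.
have x0 : \sum_(u in K) x u = 0.
  rewrite /x /signed_sum exchange_big /= big1 // => c _.
  by rewrite -mulr_sumr p0 mulr0.
have /card_gt0P[a0 a0A] : (0 < #|A|)%N by rewrite Ahalf.
have [eta [etaA etaB]] : exists eta, (forall a, a \in A -> x a <= eta) /\
    (forall b, b \in K -> b \notin A -> eta <= x b).
  case: (@arg_maxP _ _ _ a0 (mem A) x a0A) => a aA amax.
  by exists (x a); split=> [b bA|b bK bA]; [exact: amax|exact: Ax].
pose F u := (x u - eta) ^+ 2.
have cross u v : u \in K -> v \in K -> M u v * F u + M u v * F v <= M u v * (x u - x v) ^+ 2.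
  move=> uK vK; have [->|Mn0] := eqVneq (M u v) 0; first by rewrite !mul0r addr0.
  rewrite -mulrDr ler_wpM2l // /F.
  have [_ _] := Mcross u v Mn0; have [uA|uA] := boolP (u \in A); have [vA|vA] := boolP (v \in A) => // _.
    have := etaA u uA; have := etaB v vK vA; nra.
  have := etaA v vA; have := etaB u uK uA; nra.
have h1 : 2 * \sum_(u in K) F u <= \sum_(u in K) \sum_(v in K) M u v * (x u - x v) ^+ 2.
  rewrite mulr2n mulrDl !mul1r -{1}(sum_matching F MA) -(sum_matching_sym F MA) -big_split /=.
  apply: ler_sum => u uK; rewrite -big_split /=; apply: ler_sum => v vK; exact: cross.
(* The projections have mean zero, and the second moment about the mean is the smallest. *)
have h2 : \sum_(u in K) x u ^+ 2 <= \sum_(u in K) F u.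
  have -> : \sum_(u in K) F u =
      \sum_(u in K) x u ^+ 2 - 2 * eta * \sum_(u in K) x u + \sum_(u in K) eta ^+ 2.
    rewrite mulr_sumr -sumrB -big_split /=; apply: eq_bigr => u _; rewrite /F; ring.
  rewrite x0 mulr0 subr0 lerDl; apply: sumr_ge0 => u _; exact: sqr_ge0.
have h3 : \sum_(u in K) \sum_(v in K) M u v * (x u - x v) ^+ 2 <=
    4 * t ^+ 2 * \sum_(u in K) \sum_(v in K) M u v * \sum_c (p u c - p v c) ^+ 2.
  rewrite mulr_sumr; apply: ler_sum => u uK; rewrite mulr_sumr; apply: ler_sum => v vK.
  rewrite [leRHS]mulrCA ler_wpM2l //; exact: zle.
move: zbig; rewrite -/(potential p) => zbig.
move: h1 h2 h3 zbig; rewrite /x; lra.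
Qed.

End CutMatching.

(** * Flows across bisections *)

Section BisectionFlow.
Variables (R : realType) (V : finType) (e : rel V) (K : {set V}) (n : nat).
Variables (f : inputs n K -> bool) (eps : R) (h : nat -> nat -> R).
Hypothesis e_sym : symmetric e.
Hypothesis e_irr : irreflexive e.
Hypothesis hard : forall A B : {set V}, A \subset K -> B \subset K -> [disjoint A & B] ->
  (1 <= #|A| <= #|K|./2)%N -> (1 <= #|B| <= #|K|./2)%N ->
  exists xt : inputs n (K :\: (A :|: B)),
    ((h #|A| #|B|)%:E <= round_complexity2 eps (induced f xt))%E.
Variable r : nat.
Hypothesis comp : computable_in eps e f r.
Variables m N : nat.
Hypothesis N_gt0 : (0 < N)%N.
Hypothesis mN : forall y z : nat, (y <= #|K|./2)%N -> (z <= #|K|./2)%N ->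
  (#|K|./2 < y + z)%N -> m%:R * (y%:R + z%:R - (#|K|./2)%:R) <= N%:R * h y z.
Variable A : {set V}.
Hypothesis AK : A \subset K.
Hypothesis A_half : #|A| = #|K|./2.
Hypothesis B_half : #|K :\: A| = #|K|./2.

Local Notation B := (K :\: A).
Local Notation tau := (r.*2).
Local Notation node := (V * 'I_tau.+1)%type.

(** Capacities times [N], for integrality; the flow will be divided by [N] again. With supply [m] at
    each node of [A], the finite capacity [m * #|V|] already exceeds or equals the total supply and
    so replaces the infinite one. *)
Definition scaled_capacity (a b : node) : nat :=
  if b.2 != a.2.+1 :> nat then 0%N
  else if a.1 == b.1 then (m * #|V|)%N
  else if e a.1 b.1 then N else 0%N.

Lemma sum_layer (F : V -> nat) (j : 'I_tau.+1) :
  (\sum_(a : node) (if a.2 == j then F a.1 else 0) = \sum_v F v)%N.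
Proof.
rewrite -(pair_bigA _ (fun v i => if i == j then F v else 0%N)) /=.
by apply: eq_bigr => v _; rewrite -big_mkcond big_pred1_eq.
Qed.

(** The cut separates [A :&: U 0] from [B :\: U tau], so the simulation bounds [h y z] by the number
    of its edges. Both sets are nonempty because neither [y] nor [z] exceeds [#|K|./2]. *)
Lemma cut_hard (U : nat -> {set V}) (y z : nat) :
  (forall i, (i < tau)%N -> U i \subset U i.+1) ->
  y = #|A :&: U 0%N| -> z = #|B :\: U tau| -> (#|K|./2 < y + z)%N ->
  (m * (y + z - #|K|./2) <= N * #|timed_cut e r U|)%N.
Proof.
move=> Uinc yE zE yz.
have y_le : (y <= #|K|./2)%N by rewrite yE -A_half subset_leq_card // subsetIl.
have z_le : (z <= #|K|./2)%N by rewrite zE -B_half subset_leq_card // subsetDl.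
have y0 : (0 < y)%N by lia.
have z0 : (0 < z)%N by lia.
have := y0; have := z0; rewrite {1}yE {1}zE => /card_gt0P[b0 b0B] /card_gt0P[a0 a0A].
have sAK : A :&: U 0%N \subset K by apply: fintype.subset_trans AK; exact: subsetIl.
have sBK : B :\: U tau \subset K.
  by apply: fintype.subset_trans (subsetDl K A); exact: subsetDl.
have AB : [disjoint A :&: U 0%N & B :\: U tau].
  apply/pred0P => v /=; rewrite !inE; by case: (v \in A); rewrite ?andbF.
have [||xt] := hard sAK sBK AB; rewrite -?yE -?zE ?y0 ?z0 //.
have sim : computable2_in eps (induced f xt) #|timed_cut e r U|.
  apply: (@cut_simulation _ _ _ _ _ _ _ _ e_sym U _ _ xt a0 b0) => //.
    exact: subsetIr.
  apply/pred0P => v /=; rewrite !inE; by case: (v \in U tau); rewrite ?andbF.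
move=> /le_trans/(_ (ereal_inf_lbound _)) hle.
have {hle} : h y z <= #|timed_cut e r U|%:R.
  by rewrite -lee_fin; apply: hle; exists #|timed_cut e r U|.
move=> /(ler_wpM2l (ler0n R N)) /(le_trans (mN y_le z_le yz)).
by rewrite -natrD -natrB ?(ltnW yz) // -!natrM ler_nat.
Qed.

(** Three cases: [S] cuts a waiting edge, whose capacity alone covers the supply; the demand inside
    [S] covers the supply in [S]; or [y + z > #|K|./2] and [cut_hard] supplies the difference. *)
Lemma scaled_cut (S : {set node}) :
  (\sum_(a in [set a : node | (a.1 \in A) && (a.2 == ord0)] | a \in S) m <=
   \sum_(a in S | a \notin [set a : node | (a.1 \in A) && (a.2 == ord0)])
      m * ((a.1 \in B) && (a.2 == ord_max)) +
   \sum_(a in S) \sum_(b | b \notin S) scaled_capacity a b)%N.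
Proof.
pose U i := [set v : V | (v, inord i : 'I_tau.+1) \in S].
have supE : (\sum_(a in [set a : node | (a.1 \in A) && (a.2 == ord0)] | a \in S) m =
    #|A :&: U 0%N| * m)%N.
  rewrite -sum_nat_const [RHS]big_mkcond -[RHS](sum_layer _ ord0) big_mkcond /=.
  apply: eq_bigr => -[v i] _; rewrite !inE /=; case: eqP => [->|_]; rewrite ?andbF //.
  by rewrite (_ : inord 0 = ord0) ?andbT //; apply: val_inj; rewrite /= inordK.
have demE : (\sum_(a in S | a \notin [set a : node | (a.1 \in A) && (a.2 == ord0)])
      m * ((a.1 \in B) && (a.2 == ord_max)) = #|B :&: U tau| * m)%N.
  rewrite -sum_nat_const [RHS]big_mkcond -[RHS](sum_layer _ ord_max) big_mkcond /=.
  apply: eq_bigr => -[v i] _; rewrite !inE /=; case: (i =P ord_max) => [->|_]; last first.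
    by rewrite andbF muln0; case: ifP.
  rewrite (_ : inord tau = ord_max) ?andbT; last by apply: val_inj; rewrite /= inordK.
  by case: (_ \in S); case: (v \in A); case: (v \in K); rewrite /= ?muln0 ?muln1 //; case: ifP.
rewrite supE demE.
have cap_ge (a b : node) : a \in S -> b \notin S ->
    (scaled_capacity a b <= \sum_(a in S) \sum_(b | b \notin S) scaled_capacity a b)%N.
  by move=> aS bS; rewrite (bigD1 a) //= (bigD1 b) //= -addnA leq_addr.
have AU_le : (#|A :&: U 0%N| <= #|V|)%N by exact: max_card.
case: (boolP [exists i : 'I_tau, ~~ (U i \subset U i.+1)]) => [|/existsPn Uinc].
  case/existsP=> i /subsetPn[v]; rewrite !inE => vS vS'.
  have capE : scaled_capacity (v, inord i) (v, inord i.+1) = (m * #|V|)%N.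
    by rewrite /scaled_capacity /= !inordK ?ltnS ?(ltnW (ltn_ord i)) // !eqxx.
  have := cap_ge _ _ vS vS'; rewrite capE.
  by move=> le1; apply: leq_trans (leq_addl _ _); apply: leq_trans le1; rewrite mulnC leq_mul.
have {}Uinc i : (i < tau)%N -> U i \subset U i.+1.
  by move=> lt_i; have := Uinc (Ordinal lt_i); rewrite negbK.
have cutE : (N * #|timed_cut e r U| <= \sum_(a in S) \sum_(b | b \notin S) scaled_capacity a b)%N.
  pose edge (t : 'I_tau * (V * V)) : node * node :=
    ((t.2.1, inord t.1), (t.2.2, inord t.1.+1)).
  have edge_inj : injective edge.
    move=> [i [u v]] [j [u' v']] /= [-> /(congr1 val)]; rewrite /= !inordK ?ltnS 1?ltnW //.
    by move=> /val_inj -> ->.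
  rewrite pair_big_dep /= mulnC -sum_nat_const.
  apply: (@leq_trans (\sum_(t in timed_cut e r U) scaled_capacity (edge t).1 (edge t).2)).
    apply: leq_sum => -[i [u v]]; rewrite inE /= => /and3P[euv _ _].
    have uv : u == v = false by apply/negP => /eqP uv; rewrite uv e_irr in euv.
    by rewrite /scaled_capacity /= !inordK ?ltnS ?(ltnW (ltn_ord i)) // eqxx /= uv euv.
  rewrite -(big_imset (fun ab => scaled_capacity ab.1 ab.2)) /=; last by move=> ? ? _ _; exact: edge_inj.
  rewrite big_mkcond [leqRHS]big_mkcond; apply: leq_sum => ab _.
  case: ifP => // /imsetP[[i [u v]]]; rewrite inE /= => /and3P[_ uU vU] ->.
  by move: uU vU; rewrite /edge !inE /= => -> ->.
have BUE : (#|B :&: U tau| + #|B :\: U tau| = #|K|./2)%N by rewrite cardsID B_half.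
have [yz|yz] := leqP (#|A :&: U 0%N| + #|B :\: U tau|) #|K|./2.
  apply: leq_trans (leq_addr _ _); rewrite leq_mul2r; apply/orP; right.
  by rewrite -BUE leq_add2r in yz.
have := cut_hard Uinc erefl erefl yz => /leq_trans/(_ cutE) le2.
apply: leq_trans (leq_add (leqnn _) le2); rewrite mulnC [X in (_ <= X + _)%N]mulnC -mulnDr.
by rewrite leq_mul2l; apply/orP; right; move: yz; rewrite -BUE; clear; lia.
Qed.

Lemma bisection_routes :
  routes e tau (fun u (_ : unit) => m%:R / N%:R * (u \in A)%:R)
               (fun u (_ : unit) => m%:R / N%:R * (u \in B)%:R : R).
Proof.
have balance : (\sum_(a in [set a : node | (a.1 \in A) && (a.2 == ord0)]) m =
    \sum_(a | a \notin [set a : node | (a.1 \in A) && (a.2 == ord0)])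
      m * ((a.1 \in B) && (a.2 == ord_max)))%N.
  transitivity (#|A| * m)%N.
    rewrite -[RHS]sum_nat_const [RHS]big_mkcond -[RHS](sum_layer _ ord0) big_mkcond /=.
    by apply: eq_bigr => -[v i] _; rewrite !inE /=; case: eqP; rewrite ?andbT ?andbF.
  rewrite A_half -B_half -sum_nat_const [LHS]big_mkcond -[LHS](sum_layer _ ord_max).
  rewrite [RHS]big_mkcond /=; apply: eq_bigr => -[v i] _; rewrite !inE /=.
  case: (i =P ord_max) => [_|_]; last by rewrite andbF muln0; case: ifP.
  by case: (v \in A); case: (v \in K); rewrite /= ?muln0 ?muln1 //; case: ifP.
have [g [gN gc gA gB]] := gale scaled_cut balance.
have net v (i : 'I_tau.+1) : \sum_b g (v, i) b =
    (m * ((v \in A) && (i == ord0)))%:Z - (m * ((v \in B) && (i == ord_max)))%:Z.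
  have := gA (v, i); have := gB (v, i); rewrite !inE /=.
  case: (boolP ((v \in A) && (i == ord0))) => [/andP[vA _] _ /(_ isT) ->|_ /(_ isT) -> _].
    by rewrite vA /= muln0 muln1 subr0.
  by rewrite muln0 sub0r.
pose F i u v := g (u, inord i) (v, inord i.+1).
(* Edges back in time have capacity zero, so skew-symmetry makes the forward flow nonnegative. *)
have F0 i u v : (i < tau)%N -> 0 <= F i u v.
  move=> lt_i; rewrite /F gN oppr_ge0; apply: le_trans (gc _ _) _.
  rewrite /scaled_capacity /= !inordK ?ltnS // 1?ltnW //.
  by rewrite (_ : (i != i.+2) = true) //; lia.
have g0 (a b : node) : b.2 != a.2.+1 :> nat -> a.2 != b.2.+1 :> nat -> g a b = 0.
  move=> ab ba; have := gc a b; have := gc b a; rewrite (gN b a) /scaled_capacity ab ba.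
  by rewrite oppr_le0 => g1 g2; apply/eqP; rewrite eq_le g1 g2.
pose inflow i u : int := if i is j.+1 then \sum_v F j v u else 0.
have flowE i u : (i <= tau)%N -> \sum_b g (u, inord i) b =
    (if (i < tau)%N then \sum_v F i u v else 0) - inflow i u.
  move=> le_i; pose i' : 'I_tau.+1 := inord i.
  have i'E : nat_of_ord i' = i by rewrite inordK.
  pose G (c : bool) (x : int) : int := if c then x else 0.
  transitivity (\sum_(j : 'I_tau.+1) (G (nat_of_ord j == i.+1) (\sum_v g (u, i') (v, j)) -
      G (i == j.+1) (\sum_v g (v, j) (u, i')))).
    transitivity (\sum_v \sum_j g (u, i') (v, j)).
      by rewrite pair_bigA; apply: eq_bigr => -[].
    rewrite exchange_big /=; apply: eq_bigr => j _; rewrite /G; case: eqP => [jE|/eqP jE].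
      by rewrite (_ : (i == j.+1) = false) ?subr0 //; lia.
    rewrite sub0r; case: eqP => [iE|/eqP iE]; last first.
      by rewrite oppr0 big1 // => v _; apply: g0; rewrite /= i'E.
    by rewrite -sumrN; apply: eq_bigr => v _; exact: gN.
  rewrite sumrB; congr (_ - _).
    case: ifP => [lt_i|ge_i]; last first.
      rewrite big1 // => j _; rewrite /G (_ : _ == _ = false) //.
      by have := ltn_ord j; lia.
    rewrite (bigD1 (inord i.+1)) //= [X in _ + X]big1 ?addr0.
      by rewrite /G inordK ?ltnS // eqxx.
    move=> j jE; rewrite /G; case: eqP => // Ej.
    by case/eqP: jE; rewrite -Ej inord_val.
  case: i le_i i' i'E => [|i] le_i i' i'E; first by rewrite big1.
  rewrite (bigD1 (inord i)) //= [X in _ + X]big1 ?addr0.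
    by rewrite /G inordK 1?ltnW // eqxx /inflow /F -i'E inord_val.
  move=> j jE; rewrite /G; case: eqP => // -[Ej].
  by case/eqP: jE; rewrite Ej inord_val.
have N0 : (0 : R) < N%:R by rewrite ltr0n.
(* What is at [u] at time [i]: the inflow from the previous layer, plus the supply injected at layer
   [0]. *)
pose Z i u (_ : unit) : R :=
  (inflow i u + (m * ((u \in A) && (i == 0)))%:Z)%:~R / N%:R.
have conserve i u : (i <= tau)%N ->
    inflow i u + (m * ((u \in A) && (i == 0)))%:Z =
    (if (i < tau)%N then \sum_v F i u v else 0) + (m * ((u \in B) && (i == tau)))%:Z.
  move=> le_i; have := flowE i u le_i; rewrite net.
  by rewrite -!val_eqE /= inordK //; lia.
have -> : (fun u (_ : unit) => m%:R / N%:R * (u \in A)%:R) = Z 0%N.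
  apply/funext => u; apply/funext => x; rewrite /Z /= add0r andbT.
  by rewrite -pmulrn natrM mulrAC.
have -> : (fun u (_ : unit) => m%:R / N%:R * (u \in B)%:R) = Z tau.
  apply/funext => u; apply/funext => x; rewrite /Z conserve // ltnn add0r eqxx andbT.
  by rewrite -pmulrn natrM mulrAC.
apply/routesP; exists Z; split=> // i lt_i.
exists (fun u v _ => (F i u v)%:~R / N%:R); split.
- by move=> u v x; rewrite divr_ge0 // ler0z F0.
- move=> u x; rewrite -mulr_suml -rmorph_sum /Z (conserve i u (ltnW lt_i)) lt_i.
  by rewrite (ltn_eqF lt_i) andbF muln0 addr0.
- by move=> v x; rewrite -mulr_suml -rmorph_sum /Z /= andbF muln0 addr0.
- move=> u v uv; rewrite sumr_const card_unit mulr1n.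
  rewrite ler_pdivrMr //; have := gc (u, inord i) (v, inord i.+1).
  rewrite /scaled_capacity /= !inordK ?ltnS // 1?ltnW // eqxx /= (negPf uv) -/(F i u v).
  rewrite -(ler_int R); case: (e u v); by rewrite ?mul1r ?mul0r.
Qed.

End BisectionFlow.

(** * The cut-matching game *)

Section Game.
Variables (R : realType) (V : finType) (e : rel V) (K : {set V}).
Hypothesis e_sym : symmetric e.

Lemma sum_supported (S : {set V}) (F : V -> R) :
  (forall v, v \notin S -> F v = 0) -> \sum_v F v = \sum_(v in S) F v.
Proof.
by move=> F0; rewrite (bigID (mem S)) /= [X in _ + X]big1 ?addr0.
Qed.

(* Every terminal sends half of what it holds across the bisection, along the
   flow or, by time reversal, against it. *)
Lemma matching_routes t (q : R) (A : {set V}) : 0 < q -> A \subset K ->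
  routes e t (fun u (_ : unit) => q * (u \in A)%:R)
             (fun u (_ : unit) => q * (u \in K :\: A)%:R) ->
  exists2 M, cross_matching K A M & forall X : V -> V -> R,
    (forall u c, 0 <= X u c) -> (forall u c, u \notin K -> X u c = 0) ->
    (forall u, u \in K -> \sum_c X u c = q) ->
    routes e t X (mix K M X).
Proof.
move=> q0 AK rt; have qn0 : q != 0 by rewrite gt_eqF.
have [|w [w0 wA wB wr]] := routes_pairs _ rt; first by move=> u c; rewrite mulr_ge0 // ltW.
pose W a b := w a b tt.
have W0 a b : 0 <= W a b by exact: w0.
have WA a b : W a b != 0 -> a \in A.
  apply: contraR => aA; rewrite eq_le W0 andbT.
  have <- : \sum_b W a b = 0 by rewrite wA (negPf aA) mulr0.
  by rewrite (bigD1 b) //= lerDl sumr_ge0.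
have WB a b : W a b != 0 -> b \in K :\: A.
  apply: contraR => bB; rewrite eq_le W0 andbT.
  have <- : \sum_a W a b = 0 by rewrite wB (negPf bB) mulr0.
  by rewrite (bigD1 a) //= lerDl sumr_ge0.
pose M u v := (W u v + W v u) / q.
have Mcross u v : M u v != 0 -> [/\ u \in K, v \in K & (u \in A) != (v \in A)].
  have [uv0|/[dup] /WA uA /WB] := eqVneq (W u v) 0; last first.
    by rewrite inE => /andP[/negPf vA vK] _; rewrite uA vA vK (fintype.subsetP AK).
  have [vu0|/[dup] /WA vA /WB] := eqVneq (W v u) 0.
    by rewrite /M uv0 vu0 addr0 mul0r eqxx.
  by rewrite inE => /andP[/negPf uA uK] _; rewrite uA vA uK (fintype.subsetP AK).
have MK u v : v \notin K -> M u v = 0.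
  by move=> vK; apply/eqP; apply: contraR vK => /Mcross[].
exists M.
  split=> //.
  - by move=> u v; rewrite divr_ge0 ?addr_ge0 // ltW.
  - by move=> u v; rewrite /M addrC.
  - move=> u uK; rewrite -(sum_supported (MK u)) -mulr_suml big_split /=.
    rewrite (wA u tt) (wB u tt) -mulrDr !inE uK andbT mulrAC divff ?gt_eqF // mul1r.
    by case: (u \in A); rewrite ?addr0 ?add0r.
move=> X X0 XK X1.
have Xq u : \sum_c X u c / q <= 1.
  rewrite -mulr_suml; have [uK|uK] := boolP (u \in K).
    by rewrite X1 // divff // gt_eqF.
  by rewrite big1 ?mul0r // => c _; rewrite XK.
have Xq0 u c : 0 <= X u c / q by rewrite divr_ge0 // ltW.
have sumW (G H : V -> V -> R) :
    \sum_(p : V * V * unit) w p.1.1 p.1.2 p.2 * G p.1.1 p.1.2 * H p.1.1 p.1.2 =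
    \sum_a \sum_b W a b * (G a b * H a b).
  rewrite (sum_triple (fun a b c => w a b c * G a b * H a b)).
  apply: eq_bigr => a _; apply: eq_bigr => b _.
  by rewrite (bigD1 tt) //= big1 ?addr0 ?mulrA // => -[].
(* Flow from [a] to [b] carries the holdings of [a] in proportion, and the reversed flow those of
   [b]. Averaging both moves half of every holding within the capacities while the other half
   stays. *)
have fwd := routes_recode (L := fun (p : V * V * unit) c => X p.1.1 c / q)
  (fun p c => Xq0 p.1.1 c) (fun p => Xq p.1.1) wr.
have bwd := routes_recode (L := fun (p : V * V * unit) c => X p.1.2 c / q)
  (fun p c => Xq0 p.1.2 c) (fun p => Xq p.1.2) (routes_rev e_sym wr).
have half0 u c : 0 <= X u c / 2 by rewrite divr_ge0.
apply: eq_routes (routes_stay half0 (routes_mid fwd bwd)) => u c.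
  rewrite (sumW (fun a b => (u == a)%:R) (fun a b => X a c / q)).
  rewrite (sumW (fun a b => (u == b)%:R) (fun a b => X b c / q)).
  have -> : \sum_a \sum_b W a b * ((u == a)%:R * (X a c / q)) = (u \in A)%:R * X u c.
    under eq_bigr => a _ do rewrite -mulr_suml (wA a tt) mulrCA mulrC.
    by rewrite sum_delta; field.
  have -> : \sum_a \sum_b W a b * ((u == b)%:R * (X b c / q)) = (u \in K :\: A)%:R * X u c.
    rewrite exchange_big /=.
    under eq_bigr => a _ do rewrite -mulr_suml (wB a tt) mulrCA mulrC.
    by rewrite sum_delta; field.
  have [uK|uK] := boolP (u \in K); last by rewrite !XK //; ring.
  by rewrite !inE uK andbT; case: (u \in A) => /=; field.
rewrite (sumW (fun a b => (u == b)%:R) (fun a b => X a c / q)).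
rewrite (sumW (fun a b => (u == a)%:R) (fun a b => X b c / q)).
rewrite /mix -(sum_supported (F := fun v => M u v * X v c)); last first.
  by move=> v vK; rewrite XK ?mulr0.
have -> : \sum_a \sum_b W a b * ((u == b)%:R * (X a c / q)) = \sum_a W a u * (X a c / q).
  apply: eq_bigr => a _; under eq_bigr do rewrite mulrCA mulrC.
  by rewrite (sum_delta (fun b => W a b * (X a c / q))).
have -> : \sum_a \sum_b W a b * ((u == a)%:R * (X b c / q)) = \sum_b W u b * (X b c / q).
  rewrite exchange_big /=; apply: eq_bigr => b _; under eq_bigr do rewrite mulrCA mulrC.
  by rewrite (sum_delta (fun a => W a b * (X b c / q))).
rewrite -big_split /= [RHS]mulrDl addrC; congr (_ + _ / 2).
apply: eq_bigr => v _; rewrite /M; ring.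
Qed.

(** Row [u] is the mixture held by terminal [u], column [c] the whereabouts of the commodity of [c]:
    a doubly stochastic matrix on [K]. *)
Definition spread (P : V -> V -> R) : Prop :=
  [/\ forall u c, 0 <= P u c,
      forall u c, u \notin K -> P u c = 0,
      forall u, u \in K -> \sum_c P u c = 1 &
      forall c, \sum_(u in K) P u c = (c \in K)%:R].

Definition centered (P : V -> V -> R) (u c : V) : R := P u c - (c \in K)%:R / #|K|%:R.

Lemma spread_mix A M P : cross_matching K A M -> spread P -> spread (mix K M P).
Proof.
move=> MA [P0 PK P1 Pc]; have [M0 Msym M1 Mcross] := MA; split.
- move=> u c; rewrite divr_ge0 // addr_ge0 // sumr_ge0 // => v _.
  by rewrite mulr_ge0.
- move=> u c uK; rewrite /mix PK // big1 ?addr0 ?mul0r // => v _.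
  have -> : M u v = 0 by apply/eqP; apply: contraR uK => /Mcross[].
  by rewrite mul0r.
- move=> u uK; rewrite -mulr_suml big_split /= P1 // exchange_big /=.
  under eq_bigr => v vK do rewrite -mulr_sumr P1 // mulr1.
  by rewrite M1 //; lra.
- move=> c; rewrite -mulr_suml big_split /= (sum_matching_sym (P ^~ c) MA) Pc; lra.
Qed.

Lemma potential_mix_centered A M P : cross_matching K A M ->
  potential K (centered (mix K M P)) = potential K (mix K M (centered P)).
Proof.
case=> _ _ M1 _; apply: eq_bigr => u uK; apply: eq_bigr => c _; congr (_ ^+ 2).
rewrite /mix /centered; under [in RHS]eq_bigr do rewrite mulrBr.
by rewrite sumrB -mulr_suml M1 // mul1r; lra.
Qed.

Variables (t : nat) (q l : R).
Hypothesis q_gt0 : 0 < q.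
Hypothesis K_gt1 : (0 < #|K|./2)%N.
Hypothesis bisect : forall A : {set V}, A \subset K -> #|A| = #|K|./2 ->
  routes e t (fun u (_ : unit) => q * (u \in A)%:R)
             (fun u (_ : unit) => q * (u \in K :\: A)%:R).
Hypothesis l_gt0 : 0 < l.
Hypothesis l_big : 4 * #|V|%:R * #|K|%:R ^+ 2 <= expR l.

Let K_neq0 : #|K|%:R != 0 :> R.
Proof. by rewrite pnatr_eq0; apply/eqP => K0; move: K_gt1; rewrite K0. Qed.

Lemma potential_ge0 (p : V -> V -> R) : 0 <= potential K p.
Proof. by apply: sumr_ge0 => u _; apply: sumr_ge0 => c _; exact: sqr_ge0. Qed.

Lemma game_round P : spread P -> exists P',
  [/\ spread P', routes e t (fun u c => q * P u c) (fun u c => q * P' u c) &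
      potential K (centered P') <= (1 - (16 * l ^+ 2)^-1) * potential K (centered P)].
Proof.
move=> sP; have [P0 PK P1 Pc] := sP.
have [|A [AK Ahalf Adrop]] := exists_bisection K_gt1 _ l_big (p := centered P).
  by move=> c; rewrite sumrB Pc sumr_const -[X in _ - X]mulr_natr divfK // subrr.
have [M MA Mroutes] := matching_routes q_gt0 AK (bisect AK Ahalf).
exists (mix K M P); split; first exact: spread_mix MA sP.
  have := Mroutes (fun u c => q * P u c); rewrite (_ : mix K M _ = fun u c => q * mix K M P u c).
    apply.
    - by move=> u c; rewrite mulr_ge0 // ltW.
    - by move=> u c uK; rewrite PK ?mulr0.
    - by move=> u uK; rewrite -mulr_sumr P1 // mulr1.
  apply/funext => u; apply/funext => c; rewrite /mix mulrA mulrDr mulr_sumr.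
  by under eq_bigr do rewrite mulrCA.
rewrite (potential_mix_centered _ MA); apply: le_trans (mix_potential _ MA) _.
have := Adrop M MA; set D := \sum_(u in K) _; set Phi := potential K _ => h.
(* The [16] is the [4] lost in [mix_potential] times the [4] of the bisection bound. *)
have l2 : 0 < 16 * l ^+ 2 by rewrite mulr_gt0 ?exprn_gt0.
have : (16 * l ^+ 2)^-1 * Phi <= D / 4.
  by rewrite mulrC ler_pdivrMr //; lra.
by rewrite mulrBl mul1r; lra.
Qed.

Lemma game_rounds T : exists P,
  [/\ spread P,
      routes e (T * t) (fun u c => q * ((u == c) && (u \in K))%:R) (fun u c => q * P u c) &
      potential K (centered P) <= expR (- (T%:R / (16 * l ^+ 2))) * #|V|%:R ^+ 2].
Proof.
have l2 : 0 < 16 * l ^+ 2 by rewrite mulr_gt0 ?exprn_gt0.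
elim: T => [|T [P [sP rP pP]]].
  exists (fun u c => ((u == c) && (u \in K))%:R); split=> //.
    split=> //.
    - by move=> u c /negPf ->; rewrite andbF.
    - by move=> u uK; rewrite (bigD1 u) //= eqxx uK big1 ?addr0 // => c /negPf; rewrite eq_sym => ->.
    - move=> c; have [cK|cK] := boolP (c \in K).
        by rewrite (bigD1 c) //= eqxx cK big1 ?addr0 // => u /andP[_ /negPf ->].
      by rewrite big1 // => u uK; case: eqP => [uc|//]; rewrite -uc uK in cK.
  (* At the start every entry of [centered] lies between [-1] and [1], so [#|V|%:R ^+ 2] bounds the
     potential. *)
  rewrite mul0r oppr0 expR0 mul1r expr2.
  have Kle : #|K|%:R <= #|V|%:R :> R by rewrite ler_nat max_card.
  apply: (@le_trans _ _ (\sum_(u in K) #|V|%:R)); last first.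
    by rewrite sumr_const -[_ *+ _]mulr_natr ler_wpM2l.
  apply: ler_sum => u uK; apply: (@le_trans _ _ (\sum_(c : V) 1)); last first.
    by rewrite sumr_const.
  apply: ler_sum => c _; rewrite /centered.
  have K1 : 1 <= #|K|%:R :> R by rewrite ler1n; case: #|K| K_gt1.
  have /andP[] : 0 <= ((c \in K)%:R / #|K|%:R : R) <= 1.
    rewrite divr_ge0 //= ler_pdivrMr ?(lt_le_trans _ K1) // mul1r.
    by apply: le_trans K1; case: (_ \in _).
  case: (_ && _) => /=; nra.
have [P' [sP' rP' pP']] := game_round sP.
exists P'; split=> //.
  by rewrite mulSnr; exact: routes_cat rP rP'.
apply: le_trans pP' _; apply: (@le_trans _ _ (expR (- (16 * l ^+ 2)^-1) * potential K (centered P))).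
  by rewrite ler_wpM2r ?potential_ge0 //; exact: expR_ge1Dx.
set s := 16 * _ in pP *.
by rewrite -[T.+1%:R]natr1 mulrDl mul1r opprD addrC expRD -mulrA ler_wpM2l ?expR_ge0.
Qed.

(** The potential is now below [(1 / (2 * #|K|)) ^+ 2], so each entry of [P] on [K] is at least half
    of the uniform value and each pair has exchanged at least [d / 4]. The excess is discarded, and
    four repetitions deliver [d]. *)
Lemma mcf_of_game T (d : R) :
  4 * #|V|%:R ^+ 4 <= expR (T%:R / (16 * l ^+ 2)) ->
  0 <= d -> d / 2 <= q / #|K|%:R ->
  mcf_feasible e (4 * (T * t)) K d.
Proof.
move=> Tbig d0 dq; have [P [[P0 PK P1 Pc] rP pP]] := game_rounds T.
have K0 : 0 < #|K|%:R :> R by rewrite lt_def K_neq0 ler0n.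
have KV : #|K|%:R <= #|V|%:R :> R by rewrite ler_nat max_card.
have V0 : 0 < #|V|%:R :> R by exact: lt_le_trans KV.
have Plow u c : u \in K -> c \in K -> d / 4 <= q * P u c.
  move=> uK cK.
  have : centered P u c ^+ 2 <= potential K (centered P).
    rewrite /potential (bigD1 u) //= (bigD1 c) //= -addrA lerDl addr_ge0 //.
      by apply: sumr_ge0 => ? _; exact: sqr_ge0.
    by apply: sumr_ge0 => ? _; apply: sumr_ge0 => ? _; exact: sqr_ge0.
  move=> /le_trans/(_ pP).
  have : expR (- (T%:R / (16 * l ^+ 2))) * #|V|%:R ^+ 2 <= (#|K|%:R^-1 / 2) ^+ 2.
    rewrite expRN mulrC ler_pdivrMr ?expR_gt0 //.
    have iK0 : 0 < #|K|%:R^-1 :> R by rewrite invr_gt0.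
    have h : (#|V|%:R / #|K|%:R) ^+ 2 >= 1 :> R.
      by apply: exprn_ege1; rewrite ler_pdivlMr // mul1r.
    have c0 : 0 <= (#|K|%:R^-1 / 2) ^+ 2 :> R by exact: sqr_ge0.
    apply: le_trans (ler_wpM2l c0 Tbig).
    rewrite (_ : _ * (4 * _) = (#|V|%:R / #|K|%:R) ^+ 2 * #|V|%:R ^+ 2).
      by rewrite -[leLHS]mul1r ler_wpM2r ?sqr_ge0.
    by field.
  move=> h /le_trans/(_ h); rewrite /centered cK mul1r => h2.
  have Plow : #|K|%:R^-1 / 2 <= P u c.
    have : 0 < #|K|%:R^-1 :> R by rewrite invr_gt0.
    nra.
  have := ler_wpM2l (ltW q_gt0) Plow; move: dq; lra.
have [|w [w0 wX wY wr]] := routes_pairs _ rP.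
  by move=> u c; rewrite mulr_ge0 // ltW.
have wdiag a b c : a != c -> w a b c = 0.
  move=> ac; apply/eqP; rewrite eq_le w0 andbT.
  have <- : \sum_b w a b c = 0 by rewrite wX (negPf ac) mulr0.
  by rewrite (bigD1 b) //= lerDl sumr_ge0.
have wE a b : w a b a = q * P b a.
  by rewrite -wY (bigD1 a) //= big1 ?addr0 // => c ca; rewrite wdiag.
(* The fraction of the [q * P b a] units from [a] to [b] that is kept, leaving exactly [d / 4]. *)
pose kk (a b : V) : R := (d / 4) / (q * P b a) * ((a \in K) && (b \in K))%:R.
have kk0 a b : 0 <= kk a b.
  by rewrite mulr_ge0 // divr_ge0 ?mulr_ge0 ?divr_ge0 // ltW.
have kk1 a b : kk a b <= 1.
  rewrite /kk; have [/andP[aK bK]|_] := boolP (_ && _); last by rewrite mulr0.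
  rewrite mulr1; have := Plow b a bK aK; have := mulr_ge0 (ltW q_gt0) (P0 b a).
  rewrite le_eqVlt => /predU1P[<-|h0 hd]; first by rewrite invr0 mulr0.
  by rewrite ler_pdivrMr // mul1r.
have kkE a b : q * P b a * kk a b = d / 4 * ((a \in K) && (b \in K))%:R.
  rewrite /kk; have [/andP[aK bK]|_] := boolP (_ && _); last by rewrite !mulr0.
  rewrite !mulr1; have := Plow b a bK aK; have := mulr_ge0 (ltW q_gt0) (P0 b a).
  rewrite le_eqVlt => /predU1P[<-|h0 hd]; first by rewrite mul0r => hd;
    apply/eqP; rewrite eq_le hd andbT divr_ge0.
  by rewrite mulrC divfK // gt_eqF.
pose L (p : V * V * V) (s : V * V) : R := kk s.1 s.2 * ((s.1 == p.1.1)%:R * (s.2 == p.1.2)%:R).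
have LE (G : V -> V -> R) s :
    \sum_p w p.1.1 p.1.2 p.2 * G p.1.1 p.1.2 * L p s =
    d / 4 * ((s.1 \in K) && (s.2 \in K))%:R * G s.1 s.2.
  pose F a b c := w a b c * G a b * kk s.1 s.2 * (s.2 == b)%:R * (s.1 == a)%:R.
  transitivity (\sum_p F p.1.1 p.1.2 p.2).
    by apply: eq_bigr => p _; rewrite /F /L; ring.
  rewrite sum_triple /F.
  under eq_bigr do under eq_bigr do rewrite -mulr_suml -mulr_suml.
  under eq_bigr do rewrite -mulr_suml sum_delta.
  rewrite sum_delta -kkE -!mulr_suml (bigD1 s.1) //= big1 ?addr0.
    by rewrite wE; ring.
  by move=> c cs; rewrite wdiag // eq_sym.
have rL : routes e (T * t)
    (fun u (p : V * V) => d / 4 * ((p.1 \in K) && (p.2 \in K))%:R * (u == p.1)%:R)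
    (fun u (p : V * V) => d / 4 * ((p.1 \in K) && (p.2 \in K))%:R * (u == p.2)%:R).
  apply: eq_routes (routes_recode (L := L) _ _ wr).
  - by move=> u s; rewrite (LE (fun a b => (u == a)%:R)).
  - by move=> u s; rewrite (LE (fun a b => (u == b)%:R)).
  - by move=> p s; rewrite mulr_ge0 // mulr_ge0.
  move=> p; rewrite (bigD1 p.1) //= big1 ?addr0; first by rewrite /L !eqxx !mulr1.
  move=> [a b]; rewrite -pair_eqE /= /L /= negb_and => /orP[/negPf ->|/negPf ->].
    by rewrite mul0r mulr0.
  by rewrite !mulr0.
apply: mcf_of_routes; apply: eq_routes (routes_repeat 4 _ _ rL).
- by move=> u p; rewrite -mulr_natr; lra.
- by move=> u p; rewrite -mulr_natr; lra.
- by move=> u p; rewrite !mulr_ge0 // divr_ge0.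
- by move=> u p; rewrite !mulr_ge0 // divr_ge0.
Qed.

End Game.

(** * Complexity minima and the choice of parameters *)

Lemma lee_mul_emin (R : realType) (P : nat -> Prop) (c : R) (x : \bar R) :
  0 < c -> (forall r, P r -> (x <= (c * r%:R)%:E)%E) -> (x <= c%:E * emin R P)%E.
Proof.
move=> c0 xP; rewrite -lee_pdivrMl //; apply/ereal_infP => y [r Pr <-].
by rewrite lee_pdivrMl // -EFinM; exact: xP.
Qed.

Lemma tau_MCF_le (R : realType) (V : finType) (e : rel V) (K : {set V}) (n' : R) t :
  mcf_feasible e t K (n' / #|K|%:R) -> (tau_MCF e K n' <= (t%:R)%:E)%E.
Proof. by move=> ft; apply: ereal_inf_lbound; exists t. Qed.

Lemma tau_MCF_le0 (R : realType) (V : finType) (e : rel V) (K : {set V}) (n' : R) :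
  n' / #|K|%:R = 0 -> (tau_MCF e K n' <= 0)%E.
Proof.
move=> d0; apply: (@tau_MCF_le _ _ _ _ _ 0%N); rewrite d0; apply: mcf_of_routes.
by apply/funext => u; apply/funext => p; rewrite !mul0r.
Qed.

Lemma min_ratio_le (R : realType) k (h : nat -> nat -> R) y z :
  (forall y z : nat, (1 <= y <= k./2)%N -> (1 <= z <= k./2)%N -> 0 <= h y z) ->
  (y <= k./2)%N -> (z <= k./2)%N -> (k./2 < y + z)%N ->
  min_ratio k h * (y%:R + z%:R - (k./2)%:R) <= h y z.
Proof.
move=> h0 yk zk yz.
have pos (a b : nat) : (k./2 < a + b)%N -> 0 < a%:R + b%:R - (k./2)%:R :> R.
  by move=> ab; rewrite subr_gt0 -natrD ltr_nat.
rewrite -ler_pdivlMr ?pos //; apply: ge_inf; last by exists y, z.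
exists 0 => _ [a [b [ak bk ab ->]]]; apply: divr_ge0; last exact/ltW/pos.
by apply: h0; lia.
Qed.

Lemma min_ratio_ge0 (R : realType) k (h : nat -> nat -> R) :
  (0 < k./2)%N ->
  (forall y z : nat, (1 <= y <= k./2)%N -> (1 <= z <= k./2)%N -> 0 <= h y z) ->
  0 <= min_ratio k h.
Proof.
move=> k0 h0; apply: lb_le_inf.
  by exists (h k./2 k./2 / ((k./2)%:R + (k./2)%:R - (k./2)%:R)), k./2, k./2; split=> //; lia.
move=> _ [a [b [ak bk ab ->]]]; apply: divr_ge0; first by apply: h0; lia.
by rewrite subr_ge0 -natrD ler_nat ltnW.
Qed.

Theorem theorem5p1 (R : realType) :
  exists (C : R) (c : nat), 0 < C /\
  forall (V : finType) (e : rel V) (K : {set V}) (n : nat)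
         (f : inputs n K -> bool) (eps : R) (h : nat -> nat -> R),
    symmetric e -> irreflexive e ->
    ~~ odd #|K| ->
    0 <= eps ->
    (forall y z : nat, (1 <= y <= #|K|./2)%N -> (1 <= z <= #|K|./2)%N ->
       0 <= h y z) ->
    (forall A B : {set V}, A \subset K -> B \subset K -> [disjoint A & B] ->
       (1 <= #|A| <= #|K|./2)%N -> (1 <= #|B| <= #|K|./2)%N ->
       exists xt : inputs n (K :\: (A :|: B)),
         ((h #|A| #|B|)%:E <= round_complexity2 eps (induced f xt))%E) ->
    (tau_MCF e K (min_ratio #|K| h) <=
       (C * ln ((#|V| + n).+2)%:R ^+ c)%:E * round_complexity eps e f)%E.
Proof.
(* The final time is [4 * (T * 2r) = 8 * T * r], with [T <= 16 * l ^+ 3 + 1], [l <= 6 * L] and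
   [1 <= L]. *)
have [C C0 CE] : exists2 C : R, 0 < C & 8 * (16 * 6 ^+ 3 + 1) <= C.
  exists (8 * (16 * 6 ^+ 3 + 1)); last exact: lexx.
  by rewrite mulr_gt0 // addr_gt0 // mulr_gt0 // exprn_gt0.
exists C, 3%N; split=> // V e K n f eps h e_sym e_irr Keven _ h0 hard.
set x : R := (_.+2)%:R; set L := ln x; set n' := min_ratio _ _.
have L0 : 0 < L by rewrite ln_gt0 // ltr1n.
apply: lee_mul_emin => [|r comp]; first by rewrite mulr_gt0 ?exprn_gt0.
have rhs0 : (0 <= (C * L ^+ 3 * r%:R)%:E)%E.
  by rewrite lee_fin mulr_ge0 // mulr_ge0 ?exprn_ge0 // ltW.
have [K0|K0] := posnP #|K|./2.
  apply: le_trans rhs0; apply: tau_MCF_le0.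
  by have /eqP -> : #|K| == 0%N; [lia|rewrite invr0 mulr0].
have := min_ratio_ge0 K0 h0; rewrite le_eqVlt -/n' => /predU1P[n'0|n'0].
  by apply: le_trans rhs0; apply: tau_MCF_le0; rewrite -n'0 mul0r.
(* The fraction [m / N] rounds [n'] down; since [N * n' > 2], at most half of it is lost. *)
pose N := (Num.trunc (2 / n')).+1; pose m := Num.trunc (N%:R * n').
have N0 : 0 < N%:R :> R by rewrite ltr0n.
have Nn' : 2 < N%:R * n' by rewrite -ltr_pdivrMr // truncnS_gt.
have /andP[m_le m_gt] := truncn_itv (ltW (mulr_gt0 N0 n'0)).
rewrite -/m in m_le m_gt; rewrite -natr1 in m_gt.
have q_ge : n' / 2 <= m%:R / N%:R by rewrite ler_pdivlMr //; lra.
have q0 : 0 < m%:R / N%:R :> R by apply: lt_le_trans q_ge; rewrite divr_gt0.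
have mN y z : (y <= #|K|./2)%N -> (z <= #|K|./2)%N -> (#|K|./2 < y + z)%N ->
    m%:R * (y%:R + z%:R - (#|K|./2)%:R) <= N%:R * h y z.
  move=> yk zk yz; apply: le_trans (ler_wpM2l (ltW N0) (min_ratio_le h0 yk zk yz)).
  by rewrite mulrA ler_wpM2r // subr_ge0 -natrD ler_nat ltnW.
have bisect (A : {set V}) : A \subset K -> #|A| = #|K|./2 ->
    routes e r.*2 (fun u (_ : unit) => m%:R / N%:R * (u \in A)%:R : R)
                  (fun u (_ : unit) => m%:R / N%:R * (u \in K :\: A)%:R : R).
  move=> AK Ahalf; apply: (bisection_routes e_sym e_irr hard comp _ mN AK Ahalf) => //.
  by rewrite cardsD (finset.setIidPr AK) Ahalf; clear -Keven; lia.
have KV : (#|K| <= #|V|)%N by exact: max_card.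
have V2 : (2 <= #|V|)%N by clear -K0 KV; lia.
have V1 : 1 <= #|V|%:R :> R by rewrite ler1n ltnW.
have V4 : 1 <= #|V|%:R ^+ 4 :> R by exact: exprn_ege1.
(* One value serves both the projection bound [4 * #|V| * #|K| ^ 2 <= expR l] and the final accuracy
   [4 * #|V| ^ 4]. *)
pose l : R := ln (4 * #|V|%:R ^+ 4).
have pos4 : (4 * #|V|%:R ^+ 4 : R) \is Num.pos by rewrite posrE; lra.
have expl : expR l = 4 * #|V|%:R ^+ 4 by rewrite lnK.
have l0 : 0 < l by rewrite ln_gt0 //; lra.
have l_big : 4 * #|V|%:R * #|K|%:R ^+ 2 <= expR l :> R.
  rewrite expl -mulrA ler_wpM2l // [_ ^+ 4]exprS ler_wpM2l //.
  apply: (@le_trans _ _ (#|V|%:R ^+ 2)); first by rewrite lerXn2r ?nnegrE ?ler_nat.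
  by rewrite ler_weXn2l.
have xV : #|V|%:R <= x by rewrite ler_nat; clear; lia.
have x2 : 2 <= x by rewrite ler_nat.
have lL : l <= 6 * L.
  (* [4 * #|V| ^ 4 <= x ^ 6], because [x] is at least [2] and at least [#|V|]. *)
  rewrite mulrC mulr_natr -lnXn ?(lt_le_trans _ x2) // ler_ln ?posrE ?exprn_gt0 ?(lt_le_trans _ x2) //.
  rewrite (exprD x 2 4) ler_pM ?exprn_ge0 //; first by nra.
  by rewrite lerXn2r // nnegrE; lra.
have L1 : 1 <= L.
  rewrite -ler_expR lnK ?posrE ?(lt_le_trans _ x2) //.
  apply: (@le_trans _ _ 4); last by rewrite ler_nat; clear -V2; lia.
  have -> : 1 = 1 / 2 + 1 / 2 :> R by lra.
  have := expR_half_le2 R; have := expR_ge0 (1 / 2 : R); rewrite expRD; nra.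
(* Enough rounds for [T / (16 * l ^+ 2)] to reach [l]. *)
pose T := (Num.trunc (16 * l ^+ 3)).+1.
have l3 : 0 <= 16 * l ^+ 3 by rewrite mulr_ge0 ?exprn_ge0 // ltW.
have T_gt : 16 * l ^+ 3 <= T%:R by apply: ltW; exact: truncnS_gt.
have T_le : T%:R <= 16 * l ^+ 3 + 1.
  by rewrite -[T%:R]natr1 lerD2r; have /andP[] := truncn_itv l3.
have feas : mcf_feasible e (4 * (T * r.*2)) K (n' / #|K|%:R).
  apply: (mcf_of_game e_sym q0 K0 bisect l0 l_big).
  - rewrite -expl ler_expR ler_pdivlMr ?mulr_gt0 ?exprn_gt0 //.
    by apply: le_trans T_gt; rewrite mulrCA -exprS.
  - by rewrite divr_ge0 // ltW.
  - by rewrite mulrAC ler_wpM2r ?invr_ge0.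
apply: le_trans (tau_MCF_le feas) _; rewrite lee_fin.
have -> : (4 * (T * r.*2))%:R = 8 * T%:R * r%:R :> R.
  by rewrite -muln2 !natrM; ring.
rewrite ler_wpM2r //.
have : l ^+ 3 <= (6 * L) ^+ 3 by rewrite lerXn2r ?nnegrE; lra.
have L3 : 1 <= L ^+ 3 by exact: exprn_ege1.
have := ler_wpM2r (le_trans ler01 L3) CE.
rewrite exprMn; lra.
Qed.
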